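(* Consider the model $Y=XA^*+E$ described in the context, and let $\widehat A$ be a solution of $$\underset{A\in\mathbb{R}^{p\times q}}{\mathrm{minimize}}\;\Big\{\tfrac1n\ell_\tau(Y-XA)+\lambda\big(\|A\|_*+\gamma\|A\|_{1,1}\big)\Big\}$$ with truncation and tuning parameters $$\tau\gtrsim\Big(\frac{n v_\delta}{\log(pq)}\Big)^{1/\min\{1+\delta,2\}},\qquad \lambda\gtrsim v_\delta^{1/\min\{1+\delta,2\}}\Big(\frac{\log(pq)}{n}\Big)^{\min\{\delta/(1+\delta),1/2\}},\qquad \gamma>2.5 .$$ Suppose that the following two conditions hold with $\xi=(2\gamma+5)/(2\gamma-5)$, $\kappa_{\mathrm{lower}}>0$ and $\eta\gtrsim\kappa_{\mathrm{lower}}^{-1}\lambda s$: (i) (bounded moments) for some $\delta>0$, $v_\delta=\max_{i,j}\mathbb{E}(|E_{ij}|^{1+\delta})<\infty$; (ii) (localized restricted eigenvalues) there exist constants $0<\kappa_{\mathrm{lower}}\le\kappa_{\mathrm{upper}}<\infty$ such that $$\kappa_{\mathrm{lower}}/2\le\kappa_-(H_\tau(A),\xi,\eta)\le\kappa_+(H_\tau(A),\xi,\eta)\le\kappa_{\mathrm{upper}} .$$ Assume that $n>Cs^2\log(pq)$ for some sufficiently large universal constant $C>0$. Then, with probability at least $1-(pq)^{-1}$, $$\|\widehat A-A^*\|_{\mathrm F}\lesssim\kappa_{\mathrm{lower}}^{-1}\,v_\delta^{1/\min\{1+\delta,2\}}\sqrt{r s_us_v}\,\Big\{\frac{\log(pq)}{n}\Big\}^{\min\{\delta/(1+\delta),1/2\}},$$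 $$\|\widehat A-A^*\|_{*}\lesssim\kappa_{\mathrm{lower}}^{-1}\,v_\delta^{1/\min\{1+\delta,2\}}\,r s_us_v\,\Big\{\frac{\log(pq)}{n}\Big\}^{\min\{\delta/(1+\delta),1/2\}}.$$ (The result is stated conditionally on the event that (i) and (ii) hold.)
   Context: Notation: $a_n\lesssim b_n$ means $a_n\le C b_n$ for some constant $C>0$ independent of $n$; $a_n\gtrsim b_n$ means $b_n\lesssim a_n$. Model: $Y=XA^*+E$ with $Y,E\in\mathbb{R}^{n\times q}$, $X\in\mathbb{R}^{n\times p}$ a fixed design standardized so that $\max_{i,j}|X_{ij}|=1$, and $A^*\in\mathbb{R}^{p\times q}$. The rows of the random matrix $E$ are independent, mean-zero, potentially heavy-tailed random vectors. Structure of $A^*$: $A^*=U^*\Lambda^*(V^* )^{\mathsf T}=\sum_{k=1}^r\lambda_k^*u_k^*(v_k^* )^{\mathsf T}$, where $U^*\in\mathbb{R}^{p\times r}$ and $V^*\in\mathbb{R}^{q\times r}$ have orthonormal columns $u_k^*$, $v_k^*$, with $\max_k\|u_k^*\|_0\le s_u$, $\max_k\|v_k^*\|_0\le s_v$ ($\|\cdot\|_0$ counts nonzero entries), and $s_u,s_v\ll n$, $r\ll n$, $rs_us_v\ll n$. $\mathcal S=\mathrm{supp}(A^* )$ is the set of index pairs of nonzero entries of $A^*$ and $s=|\mathcal S|$ (so $s\le rs_us_v$). Norms: $\|\cdot\|_{1,1}$ is the sum of absolute values of all entries, $\|\cdot\|_*$ the nuclear norm, $\|\cdot\|_{\mathrm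 F}$ the Frobenius norm. For an index set $J\subseteq\{1,\dots,p\}\times\{1,\dots,q\}$, $U_J$ denotes the restriction of the matrix $U$ to the entries in $J$, and $J^c$ is the complement of $J$. Huber loss with robustification (truncation) parameter $\tau>0$: $\ell_\tau(z)=z^2/2$ if $|z|\le\tau$ and $\ell_\tau(z)=\tau|z|-\tau^2/2$ if $|z|>\tau$; for a matrix $M$, $\ell_\tau(M)=\sum_{i,j}\ell_\tau(M_{ij})$. Hessian: $H_\tau(A)\in\mathbb{R}^{pq\times pq}$ is the Hessian matrix of $A\mapsto\frac1n\ell_\tau(Y-XA)$, that is, $H_\tau(A)=\frac1n\sum_{i=1}^nT_{i\tau}\otimes X_{i\cdot}X_{i\cdot}^{\mathsf T}$, where $X_{i\cdot}$ is the $i$th row of $X$ written as a column vector and $T_{i\tau}$ is the $q\times q$ diagonal matrix with $j$th diagonal entry $1(|Y_{ij}-X_{i\cdot}^{\mathsf T}A_{\cdot j}|\le\tau)$. Localized restricted eigenvalues: $\kappa_-(H_\tau(A),\xi,\eta)$ and $\kappa_+(H_\tau(A),\xi,\eta)$ are respectively the infimum and the supremum, over $(A,U)\in\mathcal C(m,\xi,\eta)$, of $\mathrm{vec}(U)^{\mathsf T}H_\tau(A)\mathrm{vec}(U)/\|U\|_{\mathrm F}^2$, where $$\mathcal C(m,\xi,\eta)=\{(A,U)\in\mathbb{R}^{p\times q}\times\mathbb{R}^{p\times q}:U\ne0,\ \mathcal S\subseteq J,\ |J|\le m,\ \|U_{\mathcal S^c}\|_{1,1}\le\xi\|U_{\mathcal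 S}\|_{1,1},\ \|A-A^*\|_{1,1}\le\eta\}$$ ($J$ is an index set) is a local $\ell_{1,1}$-cone.
   Formalization: The conditions on τ and λ are read as two-sided (of the order of the stated rates, with λ's constant large enough), since lower bounds alone make the claim false; for δ>1 the constants may depend on a positive lower bound for v_δ. *)

(* Defs.v *)
(* MathComp-Analysis over an abstract realType. *)
From HB Require Import structures.
From mathcomp Require Import all_boot all_order all_algebra.
From mathcomp Require Import spectral complex mxtens.
From mathcomp Require Import all_classical all_reals all_analysis.

Set Implicit Arguments.
Unset Strict Implicit.
Unset Printing Implicit Defensive.

Import Order.TTheory GRing.Theory Num.Theory.
Import numFieldNormedType.Exports.

Local Open Scope ring_scope.

Section MatrixNorms.
Context {R : realType} {p q : nat}.
Implicit Type A : 'M[R]_(p, q).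

Definition norm11 A : R := \sum_i \sum_j `|A i j|.

Definition frob_norm A : R := Num.sqrt (\sum_i \sum_j A i j ^+ 2).

(* The singular values of A are the square roots of the eigenvalues of A^T A.
   The spectral theorem of the library is over a closed field, so A^T A is
   mapped to R[i]; being symmetric it is normal, and [spectral_diag] lists its
   eigenvalues with multiplicity.  They are real and nonnegative. *)
Definition nuclear_norm A : R :=
  \sum_(k < q)
    Num.sqrt (complex.Re
      (spectral_diag (map_mx (fun x : R => real_complex R x) (A^T *m A)) 0 k)).

Definition supp A : {set 'I_p * 'I_q} :=
  finset (fun ij : 'I_p * 'I_q => A ij.1 ij.2 != 0).

Definition mrestrict (J : {set 'I_p * 'I_q}) A : 'M[R]_(p, q) :=
  \matrix_(i, j) (if (i, j) \in J then A i j else 0).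

(* Column-stacking: entry (a, j) of U is at the position indexed by (j, a),
   which is the order that the Kronecker product T *t B of a q x q matrix T
   and a p x p matrix B uses. *)
Definition vec A : 'cV[R]_(q * p) :=
  \col_k A (mxtens_unindex k).2 (mxtens_unindex k).1.

End MatrixNorms.

Definition orthonormal_columns {R : realType} {m r : nat} (U : 'M[R]_(m, r)) :=
  U^T *m U = 1%:M.

Definition column_sparse {R : realType} {m r : nat} (s : nat)
    (U : 'M[R]_(m, r)) :=
  forall k : 'I_r, (#|[pred i | U i k != 0%R]| <= s)%N.

Definition max_abs_entry {R : realType} {m r : nat} (X : 'M[R]_(m, r)) : R :=
  \big[Num.max/0]_(i < m) \big[Num.max/0]_(j < r) `|X i j|.

Section Huber.
Context {R : realType}.

Definition huber (tau z : R) : R :=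
  if `|z| <= tau then z ^+ 2 / 2 else tau * `|z| - tau ^+ 2 / 2.

Definition huber_mx {n q : nat} (tau : R) (M : 'M[R]_(n, q)) : R :=
  \sum_i \sum_j huber tau (M i j).

Context {n p q : nat}.
Variables (X : 'M[R]_(n, p)) (Y : 'M[R]_(n, q)).

Definition huber_objective (tau lambda gamma : R) (A : 'M[R]_(p, q)) : R :=
  n%:R^-1 * huber_mx tau (Y - X *m A)
  + lambda * (nuclear_norm A + gamma * norm11 A).

Definition huber_solution (tau lambda gamma : R) (Ahat : 'M[R]_(p, q)) : Prop :=
  forall A, huber_objective tau lambda gamma Ahat
            <= huber_objective tau lambda gamma A.

Definition trunc_mx (tau : R) (A : 'M[R]_(p, q)) (i : 'I_n) : 'M[R]_q :=
  diag_mx (\row_j (`|Y i j - (X *m A) i j| <= tau)%R%:R).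

Definition huber_hessian (tau : R) (A : 'M[R]_(p, q)) : 'M[R]_(q * p) :=
  n%:R^-1 *: \sum_(i < n) tensmx (trunc_mx tau A i) ((row i X)^T *m row i X).

Definition local_cone (Astar : 'M[R]_(p, q)) (m : nat) (xi eta : R)
    (A U : 'M[R]_(p, q)) : Prop :=
  U != 0 /\
  exists J : {set 'I_p * 'I_q},
    [/\ supp Astar \subset J, (#|J| <= m)%N,
        norm11 (mrestrict (~: supp Astar) U)
          <= xi * norm11 (mrestrict (supp Astar) U)
      & norm11 (A - Astar) <= eta].

Definition hessian_quotient (tau : R) (A U : 'M[R]_(p, q)) : R :=
  ((vec U)^T *m huber_hessian tau A *m vec U) 0 0 / frob_norm U ^+ 2.

Definition cone_quotients (tau : R) (Astar : 'M[R]_(p, q)) (m : nat)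
    (xi eta : R) : set (\bar R) :=
  [set x | exists A U, local_cone Astar m xi eta A U
                       /\ x = (hessian_quotient tau A U)%:E]%classic.

(* In \bar R, so that an empty cone gives kappa_minus = +oo and
   kappa_plus = -oo. *)
Definition kappa_minus tau Astar m xi eta : \bar R :=
  ereal_inf (cone_quotients tau Astar m xi eta).

Definition kappa_plus tau Astar m xi eta : \bar R :=
  ereal_sup (cone_quotients tau Astar m xi eta).

Definition localized_RE (tau : R) (Astar : 'M[R]_(p, q)) (m : nat)
    (xi eta klower kupper : R) : Prop :=
  [/\ ((klower / 2)%:E <= kappa_minus tau Astar m xi eta)%E,
      (kappa_minus tau Astar m xi eta <= kappa_plus tau Astar m xi eta)%E
    & (kappa_plus tau Astar m xi eta <= kupper%:E)%E].

End Huber.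

Section Noise.
Context {d : measure_display} {T : measurableType d} {R : realType}.
Variable P : probability T R.

(* The whole family suffices: the other subfamilies are obtained by taking some
   of the B i to be the full space. *)
Definition mutually_independent {n : nat} {d' : measure_display}
    {T' : measurableType d'} (Z : 'I_n -> T -> T') : Prop :=
  forall B : 'I_n -> set T', (forall i, measurable (B i)) ->
    P (\bigcap_(i in [set: 'I_n]) (Z i @^-1` B i))%classic
    = (\prod_(i < n) P (Z i @^-1` B i)%classic)%E.

Context {n q : nat}.
Variable E : 'I_n -> 'I_q -> {RV P >-> R}.

Definition noise_mx (w : T) : 'M[R]_(n, q) := \matrix_(i, j) E i j w.

(* Random vector with values in R^q with its product sigma-algebra. *)
Definition noise_row (i : 'I_n) (w : T) : q.-tuple R := [tuple E i j w | j < q].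

Definition max_moment (delta : R) : \bar R :=
  (\big[maxe/0]_(i < n) \big[maxe/0]_(j < q)
     'E_P[fun w => (`|E i j w| `^ (1 + delta))%R])%E.

End Noise.

Section Rates.
Context {R : realType}.
Variables (delta v : R) (n p q : nat).

Definition log_dim : R := ln (p * q)%:R.

Definition tau_rate : R :=
  (n%:R * v / log_dim) `^ (Num.min (1 + delta) 2)^-1.

Definition stat_rate : R :=
  v `^ (Num.min (1 + delta) 2)^-1
  * (log_dim / n%:R) `^ Num.min (delta / (1 + delta)) (1 / 2).

End Rates.

(* Main.v *)
Require Import Defs.
From mathcomp Require Import all_boot all_order all_algebra.
From mathcomp Require Import spectral complex mxtens.
From mathcomp Require Import all_classical all_reals all_analysis.
From mathcomp Require Import measurable_realfun.
From mathcomp Require Import ring lra.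

(* Put D = Ahat - Astar.  Since | ||Ahat||_* - ||Astar||_* | <= ||D||_* <= ||D||_{1,1},
   on the event that the gradient of the loss at Astar is at most 3 lambda / 2
   entrywise, optimality of Ahat and convexity of the loss put D in the
   l_{1,1}-cone.  The restricted eigenvalue bound then gives quadratic growth of
   the loss along the part of the segment from Astar to Ahat that lies in the
   localization ball, which bounds t D for the largest admissible t <= 1; the
   radius eta is large enough that this bound forces t = 1.

   The gradient entries are averages over the rows of X_{ia} psi_tau(E_ij), with
   psi_tau = huber_score the derivative of the Huber loss.  Only moments of order
   alpha = min(1 + delta, 2) are available, and the exponential moment at the
   single point 1 / tau is enough for a Chernoff bound with a union bound over
   the p q entries: psi_tau / tau is bounded by 1, and its variance and its bias
   are both at most E |E_ij / tau|^alpha, which is of order log(pq) / n. *)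

Set Implicit Arguments.
Unset Strict Implicit.
Unset Printing Implicit Defensive.

Import Order.TTheory GRing.Theory Num.Theory.
Local Open Scope ring_scope.

(** * Huber loss along a line *)

Definition huber_score {R : realType} (tau z : R) : R :=
  if z <= - tau then - tau else if tau <= z then tau else z.

Lemma huber_mid {R : realType} (tau z : R) :
  - tau <= z -> z <= tau -> huber tau z = z ^+ 2 / 2.
Proof. by move=> h1 h2; rewrite /huber ler_norml h1 h2. Qed.

Lemma huber_right {R : realType} (tau z : R) :
  0 < tau -> tau <= z -> huber tau z = tau * z - tau ^+ 2 / 2.
Proof.
move=> t0 h; have z0 : 0 <= z by lra.
rewrite /huber ger0_norm //; case: ifP => // h'.
have -> : z = tau by lra.
lra.
Qed.

Lemma huber_left {R : realType} (tau z : R) :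
  0 < tau -> z <= - tau -> huber tau z = - tau * z - tau ^+ 2 / 2.
Proof.
move=> t0 h; have z0 : z <= 0 by lra.
rewrite /huber ler0_norm //; case: ifP => // h'; last lra.
have -> : z = - tau by lra.
lra.
Qed.

Lemma score_mid {R : realType} (tau z : R) :
  - tau <= z -> z <= tau -> huber_score tau z = z.
Proof. by move=> h1 h2; rewrite /huber_score; case: ifP => ?; [lra|case: ifP => ?; lra]. Qed.

Lemma score_right {R : realType} (tau z : R) :
  0 < tau -> tau <= z -> huber_score tau z = tau.
Proof. by move=> h1 h2; rewrite /huber_score; case: ifP => ?; [lra|case: ifP => ?; lra]. Qed.

Lemma score_left {R : realType} (tau z : R) :
  z <= - tau -> huber_score tau z = - tau.
Proof. by move=> h1; rewrite /huber_score h1. Qed.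

(** Intermediate value property of an affine map, with the crossing solved for explicitly; the min
    and max allow either order of [x] and [y]. *)
Lemma affine_crossing {R : realType} (a b c x y : R) :
  a + x * b < c -> c < a + y * b ->
  exists2 u, a + u * b = c & Num.min x y < u < Num.max x y.
Proof.
move=> hx hy; have b0 : b != 0.
  by apply/eqP => b0; move: hx hy; rewrite b0 !mulr0; lra.
exists ((c - a) / b); first by field.
have [xy|yx|xy] := ltgtP x y; last by rewrite xy in hx; lra.
- have bp : 0 < b by nra.
  by rewrite ltr_pdivlMr // ltr_pdivrMr //; apply/andP; split; nra.
- have bp : b < 0 by nra.
  by rewrite ltr_ndivlMr // ltr_ndivrMr //; apply/andP; split; nra.
Qed.

(** With no kink strictly inside the interval, the residual stays in one of the three pieces of the
    loss, a polynomial of degree at most two there. The midpoint identifies the piece, and Taylor's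
    formula is exact. *)
Lemma huber_taylor_segment {R : realType} (tau a b x y : R) : 0 < tau -> x < y ->
  (forall u, x < u < y -> a + u * b <> tau /\ a + u * b <> - tau) ->
  let h : R := (`|a + (x + y) / 2 * b| <= tau)%R%:R in
  huber_score tau (a + y * b) - huber_score tau (a + x * b) = h * b * (y - x) /\
  huber tau (a + y * b) - huber tau (a + x * b)
    - (y - x) * (b * huber_score tau (a + x * b)) = h * b ^+ 2 * (y - x) ^+ 2 / 2.
Proof.
move=> t0 xy nc /=; set mid := (x + y) / 2.
have hm : x < mid < y by rewrite /mid; apply/andP; split; lra.
have [mx my] := andP hm.
(* A residual strictly on one side of a kink at the midpoint stays weakly on that side up to the
   endpoints; otherwise it would cross the kink strictly inside. *)
have nlt z c : x <= z <= y -> c = tau \/ c = - tau ->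
    a + mid * b < c -> a + z * b <= c.
  move=> /andP[xz zy] hc mc; rewrite leNgt; apply/negP => cz.
  have [u uc] := affine_crossing mc cz.
  rewrite gt_min lt_max => /andP[h1 h2].
  have /nc[n1 n2] : x < u < y.
    by apply/andP; split; [case/orP: h1|case/orP: h2]; lra.
  by case: hc => hc; rewrite hc in uc.
have ngt z c : x <= z <= y -> c = tau \/ c = - tau ->
    c < a + mid * b -> c <= a + z * b.
  move=> /andP[xz zy] hc mc; rewrite leNgt; apply/negP => cz.
  have [u uc] := affine_crossing cz mc.
  rewrite gt_min lt_max => /andP[h1 h2].
  have /nc[n1 n2] : x < u < y.
    by apply/andP; split; [case/orP: h1|case/orP: h2]; lra.
  by case: hc => hc; rewrite hc in uc.
have hx : x <= x <= y by rewrite lexx ltW.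
have hy : x <= y <= y by rewrite lexx ltW.
have [n1 n2] := nc _ hm.
rewrite ler_norml.
have [h1|h1|//] := ltgtP (a + mid * b) tau.
- have [h2|h2|h2] := ltgtP (- tau) (a + mid * b); last by rewrite h2 in n2.
  + have x1 := nlt _ _ hx (or_introl erefl) h1.
    have y1 := nlt _ _ hy (or_introl erefl) h1.
    have x2 := ngt _ _ hx (or_intror erefl) h2.
    have y2 := ngt _ _ hy (or_intror erefl) h2.
    by rewrite !score_mid // !huber_mid //=; split; field.
  + have x2 := nlt _ _ hx (or_intror erefl) h2.
    have y2 := nlt _ _ hy (or_intror erefl) h2.
    by rewrite !score_left // !huber_left //=; split; field.
- have x1 := ngt _ _ hx (or_introl erefl) h1.
  have y1 := ngt _ _ hy (or_introl erefl) h1.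
  by rewrite andbF !score_right // !huber_right //=; split; field.
Qed.

(* The closed indicator [|.| <= tau] is the second derivative of the Huber loss
   except at its two kinks, so the interval is cut at the finitely many u where
   some residual meets a kink; between cuts the loss is exactly quadratic. *)
Lemma huber_sum_curvature {R : realType} {I : finType} (tau c : R) (a b : I -> R) :
  0 < tau -> forall x y, x <= y ->
  (forall u, x <= u <= y ->
     c <= \sum_i (`|a i + u * b i| <= tau)%R%:R * b i ^+ 2) ->
  c * (y - x) <= \sum_i b i * huber_score tau (a i + y * b i)
                 - \sum_i b i * huber_score tau (a i + x * b i) /\
  c * (y - x) ^+ 2 / 2 <=
    \sum_i huber tau (a i + y * b i) - \sum_i huber tau (a i + x * b i)
    - (y - x) * \sum_i b i * huber_score tau (a i + x * b i).
Proof.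
move=> t0.
(* Induction over a list of candidate cuts. The list used solves [a i + u * b i = tau] and
   [a i + u * b i = - tau]; the value of the quotient at [b i = 0] is harmless, since only moving
   residuals need a cut. *)
suff H (s : seq R) : forall x y, x <= y ->
  (forall u, x < u < y -> u \notin s ->
     forall i, b i != 0 -> a i + u * b i <> tau /\ a i + u * b i <> - tau) ->
  (forall u, x <= u <= y ->
     c <= \sum_i (`|a i + u * b i| <= tau)%R%:R * b i ^+ 2) ->
  c * (y - x) <= \sum_i b i * huber_score tau (a i + y * b i)
                 - \sum_i b i * huber_score tau (a i + x * b i) /\
  c * (y - x) ^+ 2 / 2 <=
    \sum_i huber tau (a i + y * b i) - \sum_i huber tau (a i + x * b i)
    - (y - x) * \sum_i b i * huber_score tau (a i + x * b i).
  move=> x y xy; apply: (H ([seq (tau - a i) / b i | i <- enum I] ++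
                            [seq (- tau - a i) / b i | i <- enum I])) => //.
  move=> u _; rewrite mem_cat negb_or => /andP[n1 n2] i b0; split=> e.
  - move/negP: n1; apply; apply/mapP; exists i; first by rewrite mem_enum.
    by rewrite -e; field.
  - move/negP: n2; apply; apply/mapP; exists i; first by rewrite mem_enum.
    by rewrite -e; field.
elim: s => [|z s IH] x y xy hs hc.
  have [{}xy|yx|->] := ltgtP x y; [|lra|]; last first.
    by rewrite !subrr !(expr0n, mulr0, mul0r) subr0.
  have hm : x <= (x + y) / 2 <= y by apply/andP; split; lra.
  have {}hs i u : x < u < y -> b i != 0 ->
      a i + u * b i <> tau /\ a i + u * b i <> - tau.
    by move=> hu b0; apply: hs.
  have seg i : b i * huber_score tau (a i + y * b i)
                 - b i * huber_score tau (a i + x * b i)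
               = (`|a i + (x + y) / 2 * b i| <= tau)%R%:R * b i ^+ 2 * (y - x) /\
      huber tau (a i + y * b i) - huber tau (a i + x * b i)
        - (y - x) * (b i * huber_score tau (a i + x * b i))
      = (`|a i + (x + y) / 2 * b i| <= tau)%R%:R * b i ^+ 2 * (y - x) ^+ 2 / 2.
    have [b0|b0] := eqVneq (b i) 0.
      by rewrite b0 !(mulr0, mul0r, expr0n, addr0, subrr).
    have [e1 e2] := @huber_taylor_segment R tau (a i) (b i) x y t0 xy
                      (fun u hu => hs i u hu b0).
    by rewrite -mulrBr e1 e2; split; ring.
  rewrite mulr_sumr -!sumrB.
  under eq_bigr => i _ do rewrite (seg i).1.
  rewrite -mulr_suml.
  under [X in _ /\ _ <= X]eq_bigr => i _ do rewrite (seg i).2.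
  rewrite -!mulr_suml; have := hc _ hm; set S := \sum_i _ => cS.
  have yx0 : 0 <= y - x by lra.
  by rewrite ler_wpM2r // !ler_wpM2r // exprn_ge0.
have [/andP[xz zy]|nz] := boolP (x < z < y); last first.
  apply: IH => // u hu us; apply: hs => //.
  by rewrite inE negb_or us andbT; apply: contraNneq nz => <-.
have [|||A1 A2] := IH x z; [exact: ltW| | |].
- move=> u /andP[xu uz] us; apply: hs; first by rewrite xu (lt_trans uz).
  by rewrite inE negb_or us andbT lt_eqF.
- by move=> u /andP[xu uz]; apply: hc; rewrite xu (le_trans uz) // ltW.
have [|||B1 B2] := IH z y; [exact: ltW| | |].
- move=> u /andP[zu uy] us; apply: hs; first by rewrite uy (lt_trans xz).
  by rewrite inE negb_or us andbT gt_eqF.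
- by move=> u /andP[zu uy]; apply: hc; rewrite uy andbT (le_trans _ zu) // ltW.
move: A1 A2 B1 B2; set fx := \sum_i huber _ (_ + x * _).
set fz := \sum_i huber _ (_ + z * _); set fy := \sum_i huber _ (_ + y * _).
set gx := \sum_i _ * huber_score _ (_ + x * _).
set gz := \sum_i _ * huber_score _ (_ + z * _).
set gy := \sum_i _ * huber_score _ (_ + y * _).
move=> A1 A2 B1 B2; split; first lra.
(* The slope gained on the first piece, times the length of the second, is the cross term that
   completes [(z - x) ^+ 2 + (y - z) ^+ 2] to [(y - x) ^+ 2]; hence the slope bound in the
   induction. *)
have h : (y - z) * (c * (z - x)) <= (y - z) * (gz - gx).
  by apply: ler_wpM2l => //; lra.
nra.
Qed.

(** Convexity, as the case [c = 0] of [huber_sum_curvature] for a single residual moving from [z] to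
    [w]. *)
Lemma huber_subgradient {R : realType} (tau z w : R) : 0 < tau ->
  huber_score tau z * (w - z) <= huber tau w - huber tau z.
Proof.
move=> t0.
have [||_] := @huber_sum_curvature R unit tau 0 (fun=> z) (fun=> w - z) t0 0 1.
- lra.
- by move=> u _; apply: sumr_ge0 => i _; rewrite mulr_ge0 // sqr_ge0.
rewrite !big_const !card_unit /= !addr0 !mul1r !mul0r !addr0 subr0 [z + (w - z)]addrC subrK.
lra.
Qed.

(** * Nuclear norm duality *)

Local Notation "M ^t*" := (map_mx Num.conj (M^T)) (at level 30).
Local Notation toC M := (map_mx (fun x => real_complex _ x) M).

Lemma mulmxC_adj {C : numClosedFieldType} m n k (A : 'M[C]_(m, n)) (B : 'M[C]_(n, k)) :
  (A *m B)^t* = B^t* *m A^t*.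
Proof. by rewrite trmx_mul map_mxM. Qed.

Lemma toC_adj {R : realType} p q (M : 'M[R]_(p, q)) : (toC M)^t* = toC M^T.
Proof.
by apply/matrixP => i j; rewrite !mxE; apply/eqP; rewrite eq_complex /= oppr0 !eqxx.
Qed.

Definition sing {R : realType} {p q : nat} (M : 'M[R]_(p, q)) (k : 'I_q) : R :=
  Num.sqrt (complex.Re (spectral_diag (toC (M^T *m M)) 0 k)).

Definition right_basis {R : realType} {p q : nat} (M : 'M[R]_(p, q)) : 'M[R[i]]_q :=
  spectralmx (toC (M^T *m M)).

(** The factor U Sigma of a singular value decomposition, with [right_basis M] as the remaining
    unitary factor: its columns are orthogonal, of lengths [sing M k]. *)
Definition sing_mx {R : realType} {p q : nat} (M : 'M[R]_(p, q)) : 'M[R[i]]_(p, q) :=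
  toC M *m (right_basis M)^t*.

Lemma sing_mx_gram {R : realType} {p q : nat} (M : 'M[R]_(p, q)) :
  (sing_mx M)^t* *m sing_mx M =
  diag_mx (\row_k real_complex R (sing M k) ^+ 2).
Proof.
set B := toC (M^T *m M); set S := spectralmx B; set d := spectral_diag B.
have BE : B = (toC M)^t* *m toC M by rewrite toC_adj -map_mxM.
have US : S \is unitarymx := spectral_unitarymx B.
have nB : B \is normalmx.
  by apply/normalmxP; congr (_ *m _); rewrite BE mulmxC_adj trmxCK.
have Wd : (sing_mx M)^t* *m sing_mx M = diag_mx d.
  rewrite /sing_mx /right_basis -/B -/S mulmxC_adj trmxCK.
  rewrite mulmxA -[S *m _ *m _]mulmxA -BE.
  have /orthomx_spectralP -> := nB.
  rewrite -/S -/d invmx_unitary // !mulmxA.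
  by rewrite (unitarymxP US) mul1mx mulmxtVK.
rewrite Wd; congr diag_mx; apply/rowP => k; rewrite !mxE.
(* A diagonal entry of a Gram matrix. Nonnegativity in the order of [R[i]] also makes the imaginary
   part zero, so [complex.Re] loses nothing. *)
have : 0 <= d 0 k.
  have /matrixP/(_ k k) := Wd; rewrite !mxE eqxx mulr1n => <-.
  by apply: sumr_ge0 => i _; rewrite !mxE mulrC mul_conjC_ge0.
case E : (d 0 k) => [a b]; rewrite lecE /= => /andP[/eqP b0 a0].
by rewrite -rmorphXn /= /sing -/B -/d E /= sqr_sqrtr // b0.
Qed.

Lemma unitary_sqnorm_row {C : numClosedFieldType} n (S : 'M[C]_n) i :
  S \is unitarymx -> \sum_j `|S i j| ^+ 2 = 1.
Proof.
move=> /unitarymxP/matrixP/(_ i i); rewrite !mxE eqxx mulr1n => <-.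
by apply: eq_bigr => j _; rewrite !mxE normCK.
Qed.

(* The condition on Q is that its operator norm is at most 1, tested on every
   orthonormal basis of C^q. *)
Lemma nuclear_norm_dual_le {R : realType} {p q : nat}
    (M : 'M[R]_(p, q)) (Q : 'M[R[i]]_(p, q)) :
  (forall (S : 'M[R[i]]_q) k, S \is unitarymx ->
     \sum_i `|(Q *m S^t*) i k| ^+ 2 <= 1) ->
  complex.Re (\tr (Q^t* *m toC M)) <= nuclear_norm M.
Proof.
move=> hQ; set S := right_basis M; set W := sing_mx M.
have US : S \is unitarymx := spectral_unitarymx _.
have -> : \tr (Q^t* *m toC M) = \sum_k \sum_i ((Q *m S^t*) i k)^* * W i k.
  have -> : toC M = W *m S by rewrite /W /sing_mx mulmxKtV.
  rewrite mulmxA mxtrace_mulC mulmxA -[S]trmxCK -mulmxC_adj trmxCK.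
  by apply: eq_bigr => k _; rewrite mxE; apply: eq_bigr => i _; rewrite !mxE.
rewrite raddf_sum /=; apply: ler_sum => k _; rewrite -/(sing M k).
have hd : \sum_i `|W i k| ^+ 2 = real_complex R (sing M k ^+ 2).
  have /matrixP/(_ k k) := sing_mx_gram M; rewrite !mxE eqxx mulr1n => e.
  rewrite rmorphXn /= -e; apply: eq_bigr => i _; rewrite !mxE.
  by rewrite normCKC.
have s0 : 0 <= sing M k by exact: sqrtr_ge0.
have := hQ S k US; move: hd s0; set s := sing M k; set V := Q *m S^t* => hd.
(* The weights below divide by [s]; when [s = 0], column [k] of [W] vanishes and contributes
   nothing. *)
rewrite le0r => /orP[/eqP s0|s0] hV.
  rewrite s0 big1 // => i _.
  suff -> : W i k = 0 by rewrite mulr0.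
  have := hd; rewrite s0 expr0n /=.
  move/psumr_eq0P => /(_ (fun i _ => exprn_ge0 2 (normr_ge0 _)) i isT) /eqP.
  by rewrite expf_eq0 normr_eq0 => /eqP.
(* Weighted AM-GM in place of Cauchy-Schwarz: summed over a column, the right side is at most
   [s + s^-1 * s ^+ 2], that is [2 * s]. *)
have amgm (x y : R[i]) : 2 * complex.Re (x^* * y) <=
    s * complex.Re (`|x| ^+ 2) + s^-1 * complex.Re (`|y| ^+ 2).
  rewrite !normCK; case: x => a b; case: y => c e /=.
  have h : 0 <= ((s * a - c) ^+ 2 + (s * b - e) ^+ 2) * s^-1.
    by rewrite mulr_ge0 ?addr_ge0 ?sqr_ge0 // invr_ge0 ltW.
  rewrite -subr_ge0; apply: le_trans h _; rewrite le_eqVlt; apply/orP; left.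
  by apply/eqP; field; rewrite gt_eqF.
rewrite -(ler_pM2l (ltr0Sn _ 1)) raddf_sum mulr_sumr.
apply: (le_trans (ler_sum _ (fun i _ => amgm _ _))).
rewrite big_split -!mulr_sumr -!raddf_sum hd /= expr2 mulKf ?gt_eqF //.
have : complex.Re (\sum_i `|V i k| ^+ 2) <= 1 by move: hV; rewrite lecE => /andP[].
by rewrite -(ler_pM2l s0); lra.
Qed.

(** The bound of [nuclear_norm_dual_le] is attained, so the nuclear norm is a maximum of linear
    functionals; subadditivity follows from this. *)
Lemma nuclear_norm_dual_eq {R : realType} {p q : nat} (M : 'M[R]_(p, q)) :
  exists2 Q : 'M[R[i]]_(p, q),
  (forall (S : 'M[R[i]]_q) k, S \is unitarymx ->
     \sum_i `|(Q *m S^t*) i k| ^+ 2 <= 1) &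
  nuclear_norm M = complex.Re (\tr (Q^t* *m toC M)).
Proof.
set S := right_basis M; set W := sing_mx M.
have US : S \is unitarymx := spectral_unitarymx _.
pose dv : 'rV[R[i]]_q := \row_k real_complex R (sing M k)^-1.
have dvJ : (diag_mx dv)^t* = diag_mx dv.
  apply/matrixP => i j; rewrite !mxE [j == i]eq_sym.
  case: eqP => [->|]; rewrite ?mulr1n ?mulr0n ?conjC0 //.
  by apply/eqP; rewrite eq_complex /= oppr0 !eqxx.
have MWS : toC M = W *m S by rewrite /W /sing_mx mulmxKtV.
have WG : W^t* *m W = diag_mx (\row_k real_complex R (sing M k) ^+ 2) := sing_mx_gram M.
move: W MWS WG; clearbody S => W MWS WG.
have GD : (W *m diag_mx dv)^t* *m (W *m diag_mx dv) =
    diag_mx (\row_k (sing M k != 0)%:R).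
  rewrite mulmxC_adj dvJ -mulmxA [W^t* *m _]mulmxA WG !mulmx_diag.
  congr diag_mx; apply/rowP => k; rewrite !mxE.
  have [->|s0] := eqVneq (sing M k) 0; first by rewrite rmorph0 expr0n mul0r mulr0.
  by rewrite fmorphV /=; field; rewrite fmorph_eq0.
(* Q is the partial isometry of the polar decomposition; [dv] vanishes on the
   kernel because 0^-1 = 0. *)
exists (W *m diag_mx dv *m S) => [S' k US'|].
  pose O := S *m S'^t*.
  have UO : O^t* \is unitarymx 
    by rewrite trmxC_unitary; apply: mul_unitarymx; rewrite ?trmxC_unitary.
  rewrite -mulmxA -/O; move: O UO => O UO.
  (* By [GD] this diagonal entry sums only those squared entries of column [k] of [O] whose singular
     value is nonzero, hence is at most the squared norm of a column of a unitary matrix. *)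
  have -> : \sum_i `|(W *m diag_mx dv *m O) i k| ^+ 2 =
      ((W *m diag_mx dv *m O)^t* *m (W *m diag_mx dv *m O)) k k.
    by rewrite [RHS]mxE; apply: eq_bigr => i _; rewrite !mxE normCKC.
  rewrite mulmxC_adj -mulmxA [(W *m _)^t* *m _]mulmxA GD.
  rewrite mxE -[leRHS](unitary_sqnorm_row k UO); apply: ler_sum => j _.
  rewrite mul_diag_mx !mxE.
  rewrite normCKC conjCK mulrCA mulrC.
  have := mul_conjC_ge0 (O j k); rewrite mulrC.
  by case: eqP => _ /= h; rewrite ?mul1r ?mul0r // [X in _ <= X]mulrC.
rewrite MWS !mulmxC_adj dvJ !mulmxA mxtrace_mulC !mulmxA (unitarymxP US) mul1mx.
rewrite -mulmxA WG mulmx_diag /mxtrace raddf_sum; apply: eq_bigr => k _.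
rewrite -/(sing M k) !mxE eqxx mulr1n -rmorphXn -rmorphM /=.
have [->|s0] := eqVneq (sing M k) 0; first by rewrite invr0 mul0r.
by rewrite expr2 mulKf.
Qed.

(** A dual matrix [Q] attaining the norm of [M + N] is also admissible for [M]. Testing [Q] on the
    standard basis bounds its entries by 1 in modulus, which controls the pairing with [N]. *)
Lemma nuclear_normD_le {R : realType} {p q : nat} (M N : 'M[R]_(p, q)) :
  nuclear_norm (M + N) <= nuclear_norm M + norm11 N.
Proof.
have [Q hQ ->] := nuclear_norm_dual_eq (M + N).
rewrite map_mxD mulmxDr raddfD raddfD lerD //; first exact: nuclear_norm_dual_le.
have -> : norm11 N = \sum_j \sum_i `|N i j| by rewrite exchange_big.
rewrite raddf_sum /=; apply: ler_sum => j _; rewrite mxE raddf_sum.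
apply: ler_sum => i _; rewrite !mxE.
have : `|Q i j| ^+ 2 <= 1.
  apply: le_trans (hQ 1%:M j _); last by apply/unitarymxP; rewrite trmx1 map_mx1 mulmx1.
  rewrite trmx1 map_mx1 mulmx1 (bigD1 i) //= lerDl.
  by apply: sumr_ge0 => k _; rewrite exprn_ge0.
rewrite normCK; case: (Q i j) => a b; rewrite lecE /= => /andP[_ h].
rewrite mulr0 subr0.
have a1 : `|a| <= 1 by rewrite -(ler_pXn2r (_ : 0 < 2)%N) ?nnegrE // expr1n real_normK ?num_real //; nra.
by rewrite (le_trans (ler_norm _)) // normrM ler_piMl.
Qed.

Lemma nuclear_norm_le_norm11 {R : realType} {p q : nat} (N : 'M[R]_(p, q)) :
  nuclear_norm N <= norm11 N.
Proof.
have := nuclear_normD_le 0 N; rewrite add0r.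
suff -> : nuclear_norm (0 : 'M[R]_(p, q)) = 0 by rewrite add0r.
have [Q _ ->] := nuclear_norm_dual_eq (0 : 'M[R]_(p, q)).
by rewrite map_mx0 mulmx0 mxtrace0.
Qed.

(** * Hessian and norms *)

(** The truncation matrices are diagonal, so each Kronecker product couples no two columns of [U].
    The result is the curvature sum that [huber_sum_curvature] takes as input. *)
Lemma huber_hessian_form {R : realType} {n p q : nat} (X : 'M[R]_(n, p))
    (Y : 'M[R]_(n, q)) (tau : R) (A U : 'M[R]_(p, q)) :
  ((vec U)^T *m huber_hessian X Y tau A *m vec U) 0 0 =
  n%:R^-1 * \sum_(ij : 'I_n * 'I_q)
     (`|Y ij.1 ij.2 - (X *m A) ij.1 ij.2| <= tau)%R%:R * (X *m U) ij.1 ij.2 ^+ 2.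
Proof.
rewrite /huber_hessian -scalemxAr -scalemxAl mxE; congr (_ * _).
rewrite mulmx_sumr mulmx_suml summxE -(pair_bigA _ (fun i j =>
  (`|Y i j - (X *m A) i j| <= tau)%R%:R * (X *m U) i j ^+ 2)) /=.
apply: eq_bigr => i _; rewrite mxE.
have reidx (F : 'I_(q * p) -> R) :
    \sum_k F k = \sum_j \sum_a F (mxtens_index (j, a)).
  rewrite pair_bigA /= (reindex (@mxtens_index q p)) /=.
    by apply: eq_bigr => -[].
  by exists (@mxtens_unindex q p) => k _; rewrite (mxtens_indexK, mxtens_unindexK).
rewrite reidx; apply: eq_bigr => j _.
transitivity (\sum_a (`|Y i j - (X *m A) i j| <= tau)%R%:R * (X *m U) i j * (X i a * U a j)).
  apply: eq_bigr => a _; rewrite !mxE mxtens_indexK /= mulrA; congr (_ * _).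
  rewrite reidx (bigD1 j) //= [X in _ + X]big1 ?addr0; last first.
    move=> k kj; rewrite big1 // => b _; rewrite !mxE !mxtens_indexK /=.
    by rewrite (negbTE kj) mulr0n mul0r mulr0.
  rewrite mulr_sumr mulr_suml.
  apply: eq_bigr => b _; rewrite !mxE !mxtens_indexK /= eqxx mulr1n.
  by rewrite big_ord1 !mxE; ring.
rewrite -mulr_sumr -mulrA; congr (_ * _); rewrite expr2; congr (_ * _).
by rewrite mxE.
Qed.

(** * Entrywise l1 norm, Frobenius norm and restriction to index sets *)

Lemma norm11_pair {R : realType} {p q : nat} (A : 'M[R]_(p, q)) :
  norm11 A = \sum_(ij : 'I_p * 'I_q) `|A ij.1 ij.2|.
Proof. by rewrite /norm11 pair_bigA. Qed.

Lemma norm11_ge0 {R : realType} {p q : nat} (A : 'M[R]_(p, q)) : 0 <= norm11 A.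
Proof. by rewrite norm11_pair sumr_ge0. Qed.

Lemma norm11_eq0 {R : realType} {p q : nat} (A : 'M[R]_(p, q)) :
  norm11 A = 0 -> A = 0.
Proof.
rewrite norm11_pair => /psumr_eq0P h; apply/matrixP => i j; rewrite mxE.
by apply/eqP; rewrite -normr_eq0 (h _ (i, j)).
Qed.

Lemma norm11Z {R : realType} {p q : nat} (t : R) (A : 'M[R]_(p, q)) :
  norm11 (t *: A) = `|t| * norm11 A.
Proof.
by rewrite !norm11_pair mulr_sumr; apply: eq_bigr => ij _; rewrite mxE normrM.
Qed.

Lemma norm11_restrict {R : realType} {p q : nat} (J : {set 'I_p * 'I_q})
    (A : 'M[R]_(p, q)) :
  norm11 (Defs.mrestrict J A) = \sum_(ij | ij \in J) `|A ij.1 ij.2|.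
Proof.
rewrite norm11_pair [RHS]big_mkcond; apply: eq_bigr => -[i j] _.
by rewrite mxE; case: ifP; rewrite ?normr0.
Qed.

Lemma norm11_split {R : realType} {p q : nat} (J : {set 'I_p * 'I_q})
    (A : 'M[R]_(p, q)) :
  norm11 A = norm11 (Defs.mrestrict J A) + norm11 (Defs.mrestrict (~: J) A).
Proof.
rewrite !norm11_restrict norm11_pair (bigID (fun ij => ij \in J)) /=.
by congr (_ + _); apply: eq_bigl => ij; rewrite inE.
Qed.

(** Decomposability of the l1 norm: off the support [A + D] equals [D], and on the support the
    triangle inequality applies. *)
Lemma norm11_supp_diff {R : realType} {p q : nat} (A D : 'M[R]_(p, q)) :
  norm11 A - norm11 (A + D) <=
  norm11 (Defs.mrestrict (supp A) D) - norm11 (Defs.mrestrict (~: supp A) D).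
Proof.
rewrite !norm11_restrict !norm11_pair !(bigID (fun ij => ij \in supp A) xpredT) /=.
have -> : \sum_(ij | ij \notin supp A) `|A ij.1 ij.2| = 0.
  by rewrite big1 // => ij; rewrite inE negbK => /eqP ->; rewrite normr0.
have -> : \sum_(ij | ij \notin supp A) `|(A + D) ij.1 ij.2| =
          \sum_(ij | ij \in ~: supp A) `|D ij.1 ij.2|.
  apply: eq_big => ij; first by rewrite finset.in_setC.
  by rewrite inE negbK mxE => /eqP ->; rewrite add0r.
have : \sum_(ij | ij \in supp A) `|A ij.1 ij.2| <=
    \sum_(ij | ij \in supp A) `|(A + D) ij.1 ij.2| + \sum_(ij | ij \in supp A) `|D ij.1 ij.2|.
  rewrite -big_split; apply: ler_sum => ij _ /=; rewrite mxE.
  by have := ler_normB (A ij.1 ij.2 + D ij.1 ij.2) (D ij.1 ij.2); rewrite addrK.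
lra.
Qed.

Lemma frob_sqr {R : realType} {p q : nat} (A : 'M[R]_(p, q)) :
  frob_norm A ^+ 2 = \sum_(ij : 'I_p * 'I_q) A ij.1 ij.2 ^+ 2.
Proof.
rewrite /frob_norm pair_bigA sqr_sqrtr //.
by apply: sumr_ge0 => ij _; rewrite sqr_ge0.
Qed.

Lemma frob_gt0 {R : realType} {p q : nat} (A : 'M[R]_(p, q)) :
  A != 0 -> 0 < frob_norm A.
Proof.
move=> A0; rewrite lt_neqAle sqrtr_ge0 andbT eq_sym -sqrf_eq0 frob_sqr.
apply: contra A0 => /eqP /psumr_eq0P h; apply/eqP/matrixP => i j; rewrite mxE.
by apply/eqP; rewrite -sqrf_eq0 (h _ (i, j)) // => ij _; rewrite sqr_ge0.
Qed.

Lemma norm11_restrict_frob {R : realType} {p q : nat} (J : {set 'I_p * 'I_q})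
    (A : 'M[R]_(p, q)) :
  norm11 (Defs.mrestrict J A) <= Num.sqrt #|J|%:R * frob_norm A.
Proof.
have [->|A0] := eqVneq A 0.
  rewrite norm11_restrict big1 ?mulr_ge0 ?sqrtr_ge0 // => ij _.
  by rewrite mxE normr0.
have [->|J0] := eqVneq J finset.set0.
  by rewrite norm11_restrict finset.big_set0 mulr_ge0 ?sqrtr_ge0.
have F0 := frob_gt0 A0; set F := frob_norm A in F0 *.
have S0 : 0 < Num.sqrt #|J|%:R :> R by rewrite sqrtr_gt0 ltr0n card_gt0.
have SE : #|J|%:R = Num.sqrt #|J|%:R ^+ 2 :> R by rewrite sqr_sqrtr.
set S := Num.sqrt _ in S0 SE *.
(* AM-GM: [2 |x| <= F / S + x^2 S / F], summed over J *)
have amgm (x : R) : `|x| <= (F / S + x ^+ 2 * (S / F)) / 2.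
  have h : 0 <= (F - S * `|x|) ^+ 2 * (S * F)^-1.
    by rewrite mulr_ge0 ?sqr_ge0 // invr_ge0 mulr_ge0 // ltW.
  rewrite -(real_normK (num_real x)).
  have e : (F - S * `|x|) ^+ 2 * (S * F)^-1 = F / S + `|x| ^+ 2 * (S / F) - 2 * `|x|.
    by field; rewrite !gt_eqF.
  lra.
rewrite norm11_restrict; apply: le_trans (ler_sum _ (fun ij _ => amgm _)) _.
rewrite -mulr_suml big_split /= -!mulr_suml sumr_const -mulr_natr.
have e3 : F * #|J|%:R / S = S * F by rewrite SE; field; rewrite gt_eqF.
have : \sum_(ij | ij \in J) A ij.1 ij.2 ^+ 2 <= F ^+ 2.
  rewrite /F frob_sqr [leRHS](bigID (fun ij => ij \in J)) /= lerDl.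
  by apply: sumr_ge0 => ij _; rewrite sqr_ge0.
set T := \sum_(ij | _) _ => TF.
have h : T * (S / F) <= F ^+ 2 * (S / F) by rewrite ler_wpM2r // divr_ge0 // ltW.
have e1 : F ^+ 2 * (S / F) = S * F by field; rewrite gt_eqF.
by move: e3 h TF; rewrite -/S /=; lra.
Qed.

Lemma localized_RE_curvature {R : realType} {n p q : nat} (X : 'M[R]_(n, p))
    (Y : 'M[R]_(n, q)) (tau : R) (Astar : 'M[R]_(p, q)) (m : nat)
    (xi eta kl ku : R) (A D : 'M[R]_(p, q)) :
  localized_RE X Y tau Astar m xi eta kl ku ->
  D != 0 ->
  norm11 (Defs.mrestrict (~: supp Astar) D) <= xi * norm11 (Defs.mrestrict (supp Astar) D) ->
  norm11 (A - Astar) <= eta ->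
  kl / 2 * frob_norm D ^+ 2 <= n%:R^-1 * \sum_(ij : 'I_n * 'I_q)
     (`|Y ij.1 ij.2 - (X *m A) ij.1 ij.2| <= tau)%R%:R * (X *m D) ij.1 ij.2 ^+ 2.
Proof.
move=> [h1 h2 _] D0 hD hA.
(* An empty cone would make [kappa_minus] equal to +oo and [kappa_plus] to -oo, against the middle
   inequality. Nonemptiness then gives [#|supp Astar| <= m], so the support itself is an admissible
   [J]. *)
have [x xC] : (cone_quotients X Y tau Astar m xi eta !=set0)%classic.
  apply/set0P/negP => /eqP e; move: h2.
  by rewrite /kappa_minus /kappa_plus e ereal_inf0 ereal_sup0.
have Sm : (#|supp Astar| <= m)%N.
  case: xC => A' [U' [[_ [J [SJ Jm _ _]]] _]].
  exact: leq_trans (subset_leq_card SJ) Jm.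
have : cone_quotients X Y tau Astar m xi eta (hessian_quotient X Y tau A D)%:E.
  by exists A, D; split=> //; split=> //; exists (supp Astar).
move/(ereal_inf_lbound); move/(le_trans h1); rewrite lee_fin.
rewrite /hessian_quotient huber_hessian_form ler_pdivlMr //.
by rewrite exprn_gt0 // frob_gt0.
Qed.

(** * Deterministic error bound *)

(** Minus the partial derivative of the loss in entry [(a, j)] of the coefficient matrix, as a
    function of the residual matrix [M]. *)
Definition score_gradient {R : realType} {n p q : nat} (X : 'M[R]_(n, p))
    (tau : R) (M : 'M[R]_(n, q)) (a : 'I_p) (j : 'I_q) : R :=
  n%:R^-1 * \sum_i X i a * huber_score tau (M i j).

Section Line.
Context {R : realType} {n p q : nat}.
Variables (X : 'M[R]_(n, p)) (Y : 'M[R]_(n, q)) (tau : R) (A D : 'M[R]_(p, q)).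
Hypothesis tau_gt0 : 0 < tau.

Let f (u : R) : R := n%:R^-1 * huber_mx tau (Y - X *m (A + u *: D)).
Let a (ij : 'I_n * 'I_q) : R := (Y - X *m A) ij.1 ij.2.
Let b (ij : 'I_n * 'I_q) : R := - (X *m D) ij.1 ij.2.

Lemma residual_line u ij :
  (Y - X *m (A + u *: D)) ij.1 ij.2 = a ij + u * b ij.
Proof. by rewrite /a /b mulmxDr -scalemxAr !mxE; ring. Qed.

Lemma loss_line u : f u = n%:R^-1 * \sum_ij huber tau (a ij + u * b ij).
Proof.
rewrite /f /huber_mx pair_bigA; congr (_ * _); apply: eq_bigr => ij _.
by rewrite residual_line.
Qed.

Lemma slope_line :
  n%:R^-1 * (\sum_ij b ij * huber_score tau (a ij)) =
  - \sum_(c : 'I_p * 'I_q) D c.1 c.2 * score_gradient X tau (Y - X *m A) c.1 c.2.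
Proof.
rewrite -(pair_bigA _ (fun i j => b (i, j) * huber_score tau (a (i, j)))) /=.
rewrite -(pair_bigA _ (fun c j => D c j * score_gradient X tau (Y - X *m A) c j)) /=.
rewrite exchange_big [in RHS]exchange_big /= mulr_sumr -sumrN.
apply: eq_bigr => j _; rewrite /score_gradient.
under [in RHS]eq_bigr => c _ do rewrite mulrCA mulr_sumr.
rewrite -mulr_sumr exchange_big /= -mulrN -sumrN; congr (_ * _).
apply: eq_bigr => i _; rewrite {1}/b mxE mulNr mulr_suml; congr (- _).
by apply: eq_bigr => c _; rewrite /a /=; ring.
Qed.

Lemma curvature_line c t : 0 <= t ->
  (forall u, 0 <= u <= t -> c <= n%:R^-1 * \sum_(ij : 'I_n * 'I_q)
     (`|Y ij.1 ij.2 - (X *m (A + u *: D)) ij.1 ij.2| <= tau)%R%:R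
       * (X *m D) ij.1 ij.2 ^+ 2) ->
  c * t ^+ 2 / 2 <= f t - f 0
    + t * \sum_(e : 'I_p * 'I_q) D e.1 e.2 * score_gradient X tau (Y - X *m A) e.1 e.2.
Proof.
move=> t0 hc.
have n0 : 0 <= n%:R^-1 :> R by rewrite invr_ge0.
(* For [n = 0] the inverse is 0: the hypothesis forces [c <= 0] and the right side vanishes. *)
have [n_gt0|n_eq0] := ltP 0 (n%:R : R); last first.
  have e0 : n%:R^-1 = 0 :> R by apply/eqP; rewrite invr_eq0 eq_le n_eq0 ler0n.
  have c0 : c <= 0 by have := hc 0; rewrite lexx t0 e0 mul0r => ->.
  rewrite /f /score_gradient e0 big1 => [|i _]; last by rewrite mul0r mulr0.
  by rewrite !mul0r mulr0 subrr addr0 -mulrA mulr_le0_ge0 // divr_ge0 // sqr_ge0.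
have [|_] := @huber_sum_curvature R _ tau (n%:R * c) a b tau_gt0 0 t t0.
  move=> u /hc; rewrite ler_pdivlMl // => h; apply: le_trans h _.
  rewrite le_eqVlt; apply/orP; left; apply/eqP; apply: eq_bigr => ij _.
  by rewrite -residual_line /b sqrrN !mxE.
rewrite subr0 => h.
have {h} := ler_wpM2l n0 h.
rewrite !mulrBr -!loss_line [n%:R^-1 * (t * _)]mulrCA.
under eq_bigr => ij _ do rewrite mul0r addr0.
rewrite slope_line mulrN opprK; apply: le_trans.
by rewrite le_eqVlt; apply/orP; left; apply/eqP; field; rewrite gt_eqF.
Qed.

(** The subgradient inequalities at [t] towards 0 and 1, weighted by [1 - t] and [t], have linear
    parts that cancel. *)
Lemma loss_chord t : 0 <= t <= 1 -> f t - f 0 <= t * (f 1 - f 0).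
Proof.
move=> /andP[t0 t1].
have n0 : 0 <= n%:R^-1 :> R by rewrite invr_ge0.
rewrite !loss_line -!mulrBr mulrCA ler_wpM2l // -!sumrB mulr_sumr.
apply: ler_sum => ij _; set z := a ij; set w := b ij.
have h0 := huber_subgradient (z + t * w) (z + 0 * w) tau_gt0.
have h1 := huber_subgradient (z + t * w) (z + 1 * w) tau_gt0.
move: h0 h1; set g := huber_score _ _; set l := huber tau (z + t * w).
set l0 := huber _ (z + 0 * w); set l1 := huber _ _ => h0 h1.
have {}h0 : (1 - t) * (g * (z + 0 * w - (z + t * w))) <= (1 - t) * (l0 - l).
  by rewrite ler_wpM2l // subr_ge0.
have {}h1 : t * (g * (z + 1 * w - (z + t * w))) <= t * (l1 - l).
  by rewrite ler_wpM2l.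
lra.
Qed.

End Line.

Lemma huber_estimation_error {R : realType} {n p q : nat} (X : 'M[R]_(n, p))
    (Y : 'M[R]_(n, q)) (tau lambda gamma eta kl ku : R) (m : nat)
    (Astar Ahat : 'M[R]_(p, q)) :
  let s := #|supp Astar| in
  let xi := (2 * gamma + 5) / (2 * gamma - 5) in
  let B := 4 * (gamma + 5 / 2) * (kl^-1 * lambda) in
  0 < tau -> 0 < lambda -> 5 / 2 < gamma -> 0 < kl ->
  ((0 < s)%N -> (1 + xi) * B * s%:R < eta) ->
  (forall a j, `|score_gradient X tau (Y - X *m Astar) a j| <= 3 / 2 * lambda) ->
  huber_solution X Y tau lambda gamma Ahat ->
  localized_RE X Y tau Astar m xi eta kl ku ->
  frob_norm (Ahat - Astar) <= B * Num.sqrt s%:R /\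
  nuclear_norm (Ahat - Astar) <= (1 + xi) * B * s%:R.
Proof.
move=> s xi B tau0 lam0 gam kl0 heta hG hsol hRE.
have kli : 0 < kl^-1 by rewrite invr_gt0.
have gp : 0 < gamma + 5 / 2 by lra.
have B0 : 0 < B by rewrite /B !mulr_gt0.
have xi0 : 0 < xi by apply: divr_gt0; lra.
have xi1 : 0 <= 1 + xi by lra.
set D := Ahat - Astar.
have [->|D0] := eqVneq D 0.
  split; first by rewrite /frob_norm big1 ?sqrtr0 ?mulr_ge0 ?sqrtr_ge0 ?ltW // => i _;
    rewrite big1 // => j _; rewrite mxE expr0n.
  apply: le_trans (nuclear_norm_le_norm11 _) _.
  rewrite norm11_pair big1 => [|ij _]; last by rewrite mxE normr0.
  by rewrite !mulr_ge0 // ltW.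
pose f (u : R) : R := n%:R^-1 * huber_mx tau (Y - X *m (Astar + u *: D)).
pose G := \sum_(e : 'I_p * 'I_q) D e.1 e.2 * score_gradient X tau (Y - X *m Astar) e.1 e.2.
pose N1 := norm11 D.
pose NS := norm11 (Defs.mrestrict (supp Astar) D).
pose NC := norm11 (Defs.mrestrict (~: supp Astar) D).
have N1E : N1 = NS + NC by exact: norm11_split.
have NC0 : 0 <= NC by exact: norm11_ge0.
have NS0 : 0 <= NS by exact: norm11_ge0.
have N10 : 0 < N1.
  by rewrite lt_neqAle norm11_ge0 andbT eq_sym; apply: contraNneq D0 => /norm11_eq0 ->.
have GN1 : G <= 3 / 2 * lambda * N1.
  rewrite /N1 norm11_pair mulr_sumr; apply: ler_sum => e _.
  rewrite (le_trans (ler_norm _)) // normrM mulrC ler_wpM2r //.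
have f1 : f 1 - f 0 <= lambda * (N1 + gamma * (NS - NC)).
  have := hsol Astar; rewrite /huber_objective.
  have -> : f 1 = n%:R^-1 * huber_mx tau (Y - X *m Ahat).
    by rewrite /f scale1r /D addrCA subrr addr0.
  have -> : f 0 = n%:R^-1 * huber_mx tau (Y - X *m Astar) by rewrite /f scale0r addr0.
  have h1 : norm11 Astar - norm11 Ahat <= NS - NC.
    by have := norm11_supp_diff Astar D; rewrite {1}/D addrCA subrr addr0.
  have h2 : nuclear_norm Astar <= nuclear_norm Ahat + N1.
    have := nuclear_normD_le Ahat (- D).
    have -> : norm11 (- D) = N1 by rewrite -scaleN1r norm11Z normrN normr1 mul1r.
    by have -> : Ahat - D = Astar by rewrite /D opprB addrCA subrr addr0.
  move: (n%:R^-1 * _) (n%:R^-1 * _) h1 h2 => F1 F0 h1 h2 h3.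
  have : lambda * (nuclear_norm Astar + gamma * norm11 Astar - nuclear_norm Ahat
            - gamma * norm11 Ahat) <= lambda * (N1 + gamma * (NS - NC)).
    rewrite (ler_wpM2l (ltW lam0)) //.
    have : gamma * (norm11 Astar - norm11 Ahat) <= gamma * (NS - NC).
      by rewrite ler_wpM2l //; lra.
    lra.
  lra.
have f1G : 0 <= f 1 - f 0 + G.
  have := @curvature_line R n p q X Y tau Astar D tau0 0 1 ler01 _.
  rewrite -/(f 1) -/(f 0) !mul0r mul1r; apply => u _.
  rewrite mulr_ge0 ?invr_ge0 //; apply: sumr_ge0 => ij _.
  by rewrite mulr_ge0 // sqr_ge0.
(* The 5/2 is 1 from the nuclear norm comparison plus 3/2 from the gradient bound; [xi] is the ratio
   of the two resulting coefficients. *)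
have bound : f 1 - f 0 + G <= lambda * ((gamma + 5 / 2) * NS - (gamma - 5 / 2) * NC).
  by move: f1 GN1; rewrite N1E; lra.
have cone : NC <= xi * NS.
  have : 0 <= (gamma + 5 / 2) * NS - (gamma - 5 / 2) * NC.
    by rewrite -(pmulr_rge0 _ lam0) (le_trans f1G bound).
  rewrite /xi mulrAC ler_pdivlMr; lra.
(* With an empty support the cone condition would force [D = 0]. *)
have sS : (0 < s)%N.
  rewrite lt0n; apply: contraTneq N10 => s0.
  have e : NS = 0.
    apply/eqP; rewrite eq_le NS0 andbT (le_trans (norm11_restrict_frob _ _)) //.
    by rewrite -/s s0 sqrtr0 mul0r.
  by rewrite N1E e add0r -leNgt (le_trans cone) // e mulr0.
have {}heta := heta sS.
have F0 := frob_gt0 D0; set F := frob_norm D in F0 *.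
have sqs : Num.sqrt s%:R ^+ 2 = s%:R :> R by rewrite sqr_sqrtr.
have sq0 : 0 < Num.sqrt s%:R :> R by rewrite sqrtr_gt0 ltr0n.
have NSF : NS <= Num.sqrt s%:R * F by exact: norm11_restrict_frob.
set S := Num.sqrt s%:R in sqs sq0 NSF *.
have N1F : N1 <= (1 + xi) * (S * F).
  have : (1 + xi) * NS <= (1 + xi) * (S * F) by rewrite ler_wpM2l.
  rewrite N1E; lra.
(* Quadratic growth, at least [kl / 4 * (t * F) ^+ 2], against a linear upper bound obtained from
   the chord inequality; dividing by [t * F] gives the factor 4 in [B]. *)
have local t : 0 < t -> t <= 1 -> t * N1 <= eta -> t * F <= B * S.
  move=> t0 t1 tN.
  have h := @curvature_line R n p q X Y tau Astar D tau0 (kl / 2 * F ^+ 2) t (ltW t0) _.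
  have {h} : kl / 2 * F ^+ 2 * t ^+ 2 / 2 <= f t - f 0 + t * G.
    apply: h => u /andP[u0 ut]; apply: (localized_RE_curvature hRE D0 cone).
    rewrite addrC addKr norm11Z ger0_norm // (le_trans _ tN) // ler_wpM2r //.
    exact: ltW.
  have := @loss_chord R n p q X Y tau Astar D tau0 t _.
  rewrite t1 (ltW t0) -/(f t) -/(f 1) -/(f 0) => /(_ isT) h1 h2.
  have h3 : t * (f 1 - f 0 + G) <= t * (lambda * ((gamma + 5 / 2) * (S * F))).
    rewrite ler_wpM2l ?(ltW t0) // (le_trans bound) // ler_wpM2l ?(ltW lam0) //.
    have : (gamma + 5 / 2) * NS <= (gamma + 5 / 2) * (S * F) by rewrite (ler_wpM2l (ltW gp)).
    have : 0 <= (gamma - 5 / 2) * NC by rewrite mulr_ge0 //; lra.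
    lra.
  have h4 : (t * F) * (kl / 4 * (t * F)) <= (t * F) * (lambda * ((gamma + 5 / 2) * S)).
    by move: h1 h2 h3; lra.
  move: h4; rewrite ler_pM2l ?mulr_gt0 // => h4.
  have -> : B * S = kl^-1 * 4 * (lambda * ((gamma + 5 / 2) * S)) by rewrite /B; ring.
  have -> : t * F = kl^-1 * 4 * (kl / 4 * (t * F)) by field; rewrite gt_eqF.
  by rewrite ler_wpM2l // mulr_ge0 // (ltW kli).
(* Otherwise t = eta / N1 is admissible, and the bound on t N1 = eta contradicts
   the choice of eta. *)
have N1eta : N1 <= eta.
  rewrite leNgt; apply/negP => etaN.
  have eta0 : 0 < eta.
    by apply: le_lt_trans heta; apply: mulr_ge0 => //; apply: mulr_ge0 => //; exact: ltW.
  have tE : eta / N1 * N1 = eta by rewrite divfK // gt_eqF.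
  have := local (eta / N1); rewrite divr_gt0 // ler_pdivrMr // mul1r (ltW etaN) tE lexx.
  move=> /(_ isT isT isT) h.
  have h1 : eta <= (1 + xi) * (S * (B * S)).
    rewrite -[leLHS]tE; set t := eta / N1 in h *.
    have t0 : 0 <= t by rewrite divr_ge0 // ltW.
    have h2 : t * N1 <= t * ((1 + xi) * (S * F)) by rewrite ler_wpM2l.
    have h3 : (1 + xi) * S * (t * F) <= (1 + xi) * S * (B * S).
      by rewrite ler_wpM2l // mulr_ge0 ?(ltW sq0).
    lra.
  by move: h1 heta; rewrite -sqs; lra.
have FB : F <= B * S by have := local 1 ltr01 (lexx _); rewrite !mul1r => ->.
split=> //; apply: le_trans (nuclear_norm_le_norm11 _) _; apply: le_trans N1F _.
rewrite -sqs; have : (1 + xi) * S * F <= (1 + xi) * S * (B * S).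
  by rewrite ler_wpM2l // mulr_ge0 ?(ltW sq0).
lra.
Qed.

(** * Exponential moments of independent sums *)

Section FiniteCombinations.
Context {d : measure_display} {T : measurableType d} {R : realType}.
Variable P : probability T R.

Lemma measurable_indic_comb {I : finType} (C : I -> R) (A : I -> set T) :
  (forall i, measurable (A i)) ->
  measurable_fun setT (fun w => \sum_i C i * \1_(A i) w).
Proof.
move=> mA; by apply: measurable_sum => i; apply: measurable_funM => //; apply: measurable_indic.
Qed.

Lemma integral_indic_comb {I : finType} (C : I -> R) (A : I -> set T) :
  (forall i, 0 <= C i) -> (forall i, measurable (A i)) ->
  (\int[P]_w (\sum_i C i * \1_(A i) w)%:E = (\sum_i C i * fine (P (A i)))%:E)%E.
Proof.
move=> C0 mA.
under eq_integral => w _ do rewrite -sumEFin.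
rewrite ge0_integral_sum // => [|i|i w _]; last 2 first.
- by apply/measurable_EFinP; apply: measurable_funM => //; apply: measurable_indic.
- by rewrite lee_fin mulr_ge0 // indicE.
rewrite -sumEFin; apply: eq_bigr => i _.
under eq_integral => w _ do rewrite EFinM.
rewrite ge0_integralZl_EFin //; last by apply/measurable_EFinP; apply: measurable_indic.
rewrite integral_indic // setIT EFinM fineK //.
exact: fin_num_measure.
Qed.

(** Distributing the product gives one term per choice of cells; its indicators multiply to that of
    an intersection, whose probability factorizes. *)
Lemma integral_prod_indic_comb {n : nat} {I : finType} (C : 'I_n -> I -> R)
    (A : 'I_n -> I -> set T) :
  (forall i m, 0 <= C i m) -> (forall i m, measurable (A i m)) ->
  (forall k : 'I_n -> I, P (\bigcap_(i in [set: 'I_n]) A i (k i))%classic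
                         = (\prod_(i < n) P (A i (k i)))%E) ->
  (\int[P]_w (\prod_i \sum_m C i m * \1_(A i m) w)%:E
   = (\prod_i \sum_m C i m * fine (P (A i m)))%:E)%E.
Proof.
move=> C0 mA indep.
under eq_integral => w _ do rewrite bigA_distr_bigA /=.
rewrite bigA_distr_bigA /=.
transitivity (\int[P]_w (\sum_(f : {ffun 'I_n -> I}) (\prod_i C i (f i)) *
    \1_(\bigcap_(i in [set: 'I_n]) A i (f i))%classic w)%:E)%E.
  apply: eq_integral => w _; congr EFin; apply: eq_bigr => f _.
  rewrite big_split /=; congr (_ * _).
  rewrite indicE; have [h|h] := boolP (w \in _).
    rewrite big1 // => i _; rewrite indicE mem_set //.
    by move: h; rewrite inE => /(_ i); apply.
  have [i hi] : exists i, ~ A i (f i) w.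
    apply/existsNP => hall; move/negP: h; apply; rewrite inE => i _; exact: hall.
  by rewrite (bigD1 i) //= indicE memNset // mul0r.
rewrite integral_indic_comb => [|f|f]; last 2 first.
- exact: prodr_ge0.
- by apply: fin_bigcap_measurable.
congr EFin; apply: eq_bigr => f _; rewrite big_split /=; congr (_ * _).
apply: EFin_inj; rewrite fineK; last by apply: fin_num_measure; apply: fin_bigcap_measurable.
rewrite indep -prodEFin; apply: eq_bigr => i _.
by rewrite fineK //; exact: fin_num_measure.
Qed.

End FiniteCombinations.

Section ExpMoments.
Context {d : measure_display} {T : measurableType d} {R : realType}.
Variable P : probability T R.

(* Independence is only used on events, so each Z i is rounded up to the grid of
   mesh 1 / n before expanding the product; rounding costs a factor exp(1 / n)
   per variable, hence the summand 1. *)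
Lemma expectation_exp_sum_le {n : nat} (Z : 'I_n -> T -> R) (b : 'I_n -> R) :
  (forall i, measurable_fun setT (Z i)) -> (forall i w, `|Z i w| <= 1) ->
  (forall B : 'I_n -> set R, (forall i, measurable (B i)) ->
    P (\bigcap_(i in [set: 'I_n]) (Z i @^-1` B i))%classic
    = (\prod_(i < n) P (Z i @^-1` B i)%classic)%E) ->
  (forall i, (\int[P]_w (expR (Z i w))%:E <= (expR (b i))%:E)%E) ->
  (\int[P]_w (expR (\sum_i Z i w))%:E <= (expR (1 + \sum_i b i))%:E)%E.
Proof.
move=> mZ Z1 indep hb.
have [n0|n_gt0] := posnP n.
  rewrite (_ : 1 + _ = 1); last first.
    by rewrite big1 ?addr0 // => -[i hi]; exfalso; rewrite n0 in hi.
  rewrite (eq_integral (cst 1%:E)) => [|w _]; last first.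
    by rewrite big1 ?expR0 // => -[i hi]; exfalso; rewrite n0 in hi.
  rewrite integral_cst // mul1e.
  by apply: le_trans (probability_le1 P measurableT) _; rewrite lee_fin; have := expR_ge1Dx (1 : R); lra.
have nR : 0 < n%:R :> R by rewrite ltr0n.
(* Half-open cells covering [-1, 1]; the cell with index 2n is there for the value 1. [C m] is the
   exponential of the right end of cell [m]. *)
pose B (m : 'I_(n.*2.+1)) : set R := `[m%:R / n%:R - 1, m.+1%:R / n%:R - 1[%classic.
pose C (m : 'I_(n.*2.+1)) : R := expR (m.+1%:R / n%:R - 1).
pose A i m : set T := (Z i @^-1` B m)%classic.
have mB m : measurable (B m) by exact: measurable_itv.
have mA i m : measurable (A i m).
  by rewrite -[A i m]setTI; exact: mZ.
pose h i w := \sum_m C m * \1_(A i m) w.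
have hE i w : exists2 m : 'I_(n.*2.+1), h i w = C m &
    m%:R / n%:R - 1 <= Z i w < m.+1%:R / n%:R - 1.
  have := Z1 i w; rewrite ler_norml => /andP[z1 z2].
  pose y := (Z i w + 1) * n%:R.
  have y0 : 0 <= y by rewrite mulr_ge0 ?ler0n //; lra.
  have ylt : (Num.truncn y < n.*2.+1)%N.
    rewrite truncn_lt_nat // -addn1 natrD -mul2n natrM.
    have : y <= 2 * n%:R by rewrite ler_wpM2r ?ler0n //; lra.
    by rewrite mulr1n; lra.
  have := truncn_itv y0 => /andP[y1 y2].
  have hm : (Ordinal ylt)%:R / n%:R - 1 <= Z i w < (Ordinal ylt).+1%:R / n%:R - 1.
    by rewrite lerBlDr ltrBrDr ler_pdivrMr // ltr_pdivlMr // y1 y2.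
  exists (Ordinal ylt) => //.
  rewrite /h (bigD1 (Ordinal ylt)) //= indicE mem_set ?mulr1; last first.
    by rewrite /A /B /= in_itv.
  rewrite big1 ?addr0 // => m hmne; rewrite indicE memNset ?mulr0 //.
  rewrite /A /B /= in_itv /= => /andP[]; rewrite lerBlDr ltrBrDr ler_pdivrMr // ltr_pdivlMr //.
  move=> w1 w2; move/negP: hmne; apply; apply/eqP/val_inj => /=.
  by symmetry; apply: truncn_def; rewrite w1 w2.
have h0 i w : 0 <= h i w by have [m -> _] := hE i w; exact: expR_ge0.
have hge i w : expR (Z i w) <= h i w.
  by have [m -> /andP[_ /ltW]] := hE i w; rewrite ler_expR.
have hle i w : h i w <= expR n%:R^-1 * expR (Z i w).
  have [m -> /andP[z1 _]] := hE i w; rewrite -expRD ler_expR -natr1 mulrDl; lra.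
have mh i : measurable_fun setT (h i) by exact: measurable_indic_comb.
have int_h i : ((\sum_m C m * fine (P (A i m)))%:E <= (expR (n%:R^-1 + b i))%:E)%E.
  rewrite -integral_indic_comb // => [|m]; last exact: expR_ge0.
  apply: (@le_trans _ _ (\int[P]_w ((expR n%:R^-1)%:E * (expR (Z i w))%:E))%E).
    apply: ge0_le_integral => //.
    - by move=> w _; rewrite lee_fin; exact: h0.
    - by apply/measurable_EFinP; exact: mh.
    - by apply/measurable_EFinP; apply: measurable_funM => //;
        exact: measurableT_comp.
    - by move=> w _; rewrite -EFinM lee_fin; exact: hle.
  rewrite ge0_integralZl_EFin ?expR_ge0 //.
  - by rewrite expRD EFinM lee_wpmul2l // lee_fin expR_ge0.
  - by apply/measurable_EFinP; exact: measurableT_comp.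
apply: (@le_trans _ _ (\int[P]_w (\prod_i h i w)%:E)%E).
  apply: ge0_le_integral => //.
  - apply/measurable_EFinP; apply: measurableT_comp => //.
    exact: measurable_sum.
  - apply/measurable_EFinP.
    exact: measurable_prod.
  - move=> w _; rewrite lee_fin (big_morph expR (@expRD R) (expR0 R)); apply: ler_prod => i _.
    by rewrite expR_ge0 hge.
rewrite integral_prod_indic_comb // => [|i m|k]; last 2 first.
- exact: expR_ge0.
- by rewrite indep.
rewrite lee_fin.
have -> : 1 + \sum_i b i = \sum_(i < n) (n%:R^-1 + b i).
  by rewrite big_split /= sumr_const card_ord -[_ *+ n]mulr_natr mulVf ?gt_eqF.
rewrite (big_morph expR (@expRD R) (expR0 R)); apply: ler_prod => i _; rewrite sumr_ge0 /= => [|m _].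
  by rewrite -lee_fin.
by rewrite mulr_ge0 ?expR_ge0 ?fine_ge0.
Qed.

End ExpMoments.

(** * Truncated moments *)

(** The exponential is the inverse square of [expR (- (y / 2))], which is at least [1 - y / 2]. The
    remaining polynomial inequality has difference [y ^+ 2 * (1 - y) * (5 - 2 * y) / 4]. *)
Lemma expR_le_quadratic {R : realType} (y : R) : y <= 1 -> expR y <= 1 + y + 2 * y ^+ 2.
Proof.
move=> y1; have h : 0 < 1 - y / 2 by lra.
have q0 : 0 < 1 + y + 2 * y ^+ 2 by have := sqr_ge0 (y + 1 / 4); lra.
have e : expR y = (expR (- (y / 2)) ^+ 2)^-1.
  by rewrite expr2 -expRD -expRN; congr expR; lra.
rewrite e invf_ple ?posrE ?exprn_gt0 ?expR_gt0 //.
apply: (@le_trans _ _ ((1 - y / 2) ^+ 2)).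
  rewrite invf_ple ?posrE ?exprn_gt0 //.
  rewrite -[leLHS]div1r ler_pdivrMr ?exprn_gt0 //.
  have : 0 <= y ^+ 2 * ((1 - y) * (5 - 2 * y)).
    by apply: mulr_ge0; [exact: sqr_ge0|apply: mulr_ge0; lra].
  lra.
rewrite ler_pXn2r // ?nnegrE ?expR_ge0 ?(ltW h) //.
by have := expR_ge1Dx (- (y / 2)); lra.
Qed.

Lemma huber_score_bound {R : realType} (tau z : R) : 0 < tau ->
  `|huber_score tau z| <= tau.
Proof.
move=> t0; rewrite ler_norml /huber_score.
by case: (leP z (- tau)) => h1; [|case: (leP tau z) => h2]; apply/andP; split; lra.
Qed.

Lemma huber_scoreE {R : realType} (tau z : R) : 0 < tau ->
  huber_score tau z = Num.max (- tau) (Num.min z tau).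
Proof.
move=> t0; rewrite /huber_score.
have [h1|h1] := leP z (- tau).
  by rewrite min_l ?max_l //; lra.
have [h2|h2] := leP tau z; first by rewrite max_r //; lra.
by rewrite max_r // ltW.
Qed.

Lemma measurable_huber_score {R : realType} (tau : R) : 0 < tau ->
  measurable_fun setT (huber_score tau).
Proof.
move=> t0; rewrite (_ : huber_score tau = (fun z => Num.max (- tau) (Num.min z tau))).
  apply: measurable_maxr; first exact: measurable_cst.
  by apply: measurable_minr => //; exact: measurable_cst.
by apply/funext => z; exact: huber_scoreE.
Qed.

(** The factor 3 is 2 for the square of the clipped variable and 1 for its bias. Inside the
    truncation range the bias is zero and [alpha <= 2] bounds the square; outside, the square is at
    most 1 and [1 <= alpha] bounds the bias. *)
Lemma expR_huber_score_le {R : realType} (tau x z alpha : R) :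
  0 < tau -> `|x| <= 1 -> 1 <= alpha <= 2 ->
  expR (x * huber_score tau z / tau) <=
  1 + x / tau * z + 3 * (`|z| / tau) `^ alpha.
Proof.
move=> t0 x1 /andP[a1 a2]; set y := `|z| / tau.
have y0 : 0 <= y by rewrite divr_ge0 // ltW.
set g := huber_score tau z / tau.
have g1 : `|g| <= 1.
  by rewrite normrM normfV (gtr0_norm t0) ler_pdivrMr // mul1r huber_score_bound.
have xg1 : `|x * g| <= 1.
  by rewrite normrM -[leRHS]mulr1 ler_pM.
have xg2 : (x * g) ^+ 2 <= g ^+ 2.
  rewrite exprMn ler_piMl ?sqr_ge0 // -(real_normK (num_real x)).
  by rewrite exprn_ile1.
have [gy bias] : g ^+ 2 <= y `^ alpha /\ `|g - z / tau| <= y `^ alpha.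
  have [zt|tz] := leP `|z| tau.
    have [z1 z2] : - tau <= z /\ z <= tau by move: zt; rewrite ler_norml => /andP[].
    have -> : g = z / tau by rewrite /g score_mid.
    split; last by rewrite subrr normr0 powR_ge0.
    have -> : (z / tau) ^+ 2 = y ^+ 2.
      by rewrite /y !exprMn real_normK ?num_real.
    have [->|yn0] := eqVneq y 0; first by rewrite expr0n powR_ge0.
    rewrite -powR_mulrn //; apply: ger_powR => //.
    by rewrite lt_neqAle eq_sym yn0 y0 /= /y ler_pdivrMr // mul1r.
  have y1 : 1 <= y by rewrite /y ler_pdivlMr // mul1r ltW.
  have ya : y <= y `^ alpha by rewrite -[leLHS]powRr1 //; exact: ler_powR.
  split.
    rewrite -(real_normK (num_real g)); apply: le_trans (_ : 1 <= _); last lra.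
    by rewrite exprn_ile1.
  apply: le_trans ya; move: tz; have [z0|z0] := leP 0 z => tz.
    rewrite ger0_norm // in tz; rewrite /g score_right //; last exact: ltW.
    rewrite divff ?gt_eqF //.
    have -> : z / tau = y by rewrite /y ger0_norm.
    by rewrite ler0_norm; lra.
  rewrite ltr0_norm // in tz; rewrite /g score_left; last by lra.
  rewrite mulNr divff ?gt_eqF //.
  have -> : z / tau = - y by rewrite /y ltr0_norm // mulNr opprK.
  by rewrite ger0_norm; lra.
have -> : x * huber_score tau z / tau = x * g by rewrite mulrA.
have h1 : x * g <= 1 by rewrite (le_trans (ler_norm _)).
apply: le_trans (expR_le_quadratic h1) _.
have : x * (g - z / tau) <= y `^ alpha.
  rewrite (le_trans (ler_norm _)) // normrM (le_trans _ bias) //.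
  by rewrite ler_piMl.
have -> : x / tau * z = x * (z / tau) by ring.
lra.
Qed.

(** Passes from order [Num.min (1 + delta) 2] to the assumed order. The indicator pays for
    [|z| <= 1] when [delta > 1], where the higher power is the smaller one. *)
Lemma powR_min2_le {R : realType} (delta z : R) : 0 < delta ->
  `|z| `^ Num.min (1 + delta) 2 <= `|z| `^ (1 + delta) + (1 < delta)%R%:R.
Proof.
move=> d0; have [d1|d1] := ltP 1 delta; last first.
  by rewrite addr0 (_ : Num.min _ _ = 1 + delta) //; apply/min_idPl; lra.
rewrite (_ : Num.min _ _ = 2); last by apply/min_idPr; lra.
have [z1|z1] := leP `|z| 1.
  apply: (@le_trans _ _ 1); last by rewrite /= lerDr powR_ge0.
  by rewrite powR_mulrn // exprn_ile1.
by rewrite ler_wpDr //; apply: ler_powR; lra.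
Qed.

Section Moments.
Context {d : measure_display} {T : measurableType d} {R : realType}.
Variable P : probability T R.

(** Integrating the pointwise bound removes the linear term because [Z] is centered; then
    [1 + u <= expR u]. *)
Lemma expectation_exp_score_le (Z : {RV P >-> R}) (delta v tau x : R) :
  0 < delta -> 0 < tau -> `|x| <= 1 -> ('E_P[Z] = 0)%E ->
  ('E_P[fun w => (`|Z w| `^ (1 + delta))%R] <= v%:E)%E ->
  (\int[P]_w (expR (x * huber_score tau (Z w) / tau))%:E <=
   (expR (3 * (v + (1 < delta)%R%:R) / tau `^ Num.min (1 + delta) 2))%:E)%E.
Proof.
move=> d0 t0 x1; rewrite unlock => EZ Ev.
set alpha := Num.min (1 + delta) 2.
set D : R := (1 < delta)%R%:R.
have a12 : 1 <= alpha <= 2.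
  by rewrite /alpha le_min ge_min lexx orbT andbT; apply/andP; split; lra.
set c := 3 / tau `^ alpha.
have c0 : 0 <= c by rewrite divr_ge0 ?powR_ge0.
have mZ : measurable_fun setT (Z : T -> R) by exact: measurable_funPT.
have mpow : measurable_fun setT (fun w => `|Z w| `^ (1 + delta)).
  apply: (@measurableT_comp _ _ _ _ _ _ (fun y : R => y `^ (1 + delta))).
    exact: measurable_powR.
  exact: measurableT_comp.
have ipow : P.-integrable setT (fun w => (`|Z w| `^ (1 + delta))%:E).
  apply/integrableP; split; first exact/measurable_EFinP.
  under eq_integral => w _ do rewrite gee0_abs ?lee_fin ?powR_ge0 //.
  by apply: le_lt_trans Ev _; exact: ltry.
have icst (k : R) : P.-integrable setT (fun=> k%:E).
  exact: finite_measure_integrable_cst.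
have iZ : P.-integrable setT (fun w => (Z w)%:E).
  apply: (@le_integrable _ _ _ _ _ measurableT _
    (fun w => 1%:E + (`|Z w| `^ (1 + delta))%:E)%E); last exact: integrableD.
  - exact/measurable_EFinP.
  - move=> w _; rewrite -EFinD lee_fin [leRHS]ger0_norm ?addr_ge0 ?powR_ge0 //.
    have [z1|z1] := leP `|Z w| 1; first by rewrite ler_wpDr // powR_ge0.
    rewrite ler_wpDl // -[leLHS]powRr1 //; apply: ler_powR; lra.
pose F w : R := (1 + c * D) + x / tau * Z w + c * `|Z w| `^ (1 + delta).
have FE : (fun w => (F w)%:E) = (fun w => ((1 + c * D)%:E + (x / tau)%:E * (Z w)%:E)
    + c%:E * (`|Z w| `^ (1 + delta))%:E)%E.
  by apply/funext => w; rewrite -!EFinM -!EFinD.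
have i1 : P.-integrable setT (fun w => (1 + c * D)%:E + (x / tau)%:E * (Z w)%:E)%E.
  by apply: integrableD => //; exact: integrableZl.
have i2 : P.-integrable setT (fun w => c%:E * (`|Z w| `^ (1 + delta))%:E)%E.
  exact: integrableZl.
have Fge w : expR (x * huber_score tau (Z w) / tau) <= F w.
  apply: le_trans (expR_huber_score_le (Z w) t0 x1 a12) _; rewrite -/alpha.
  have e : 3 * (`|Z w| / tau) `^ alpha = c * `|Z w| `^ alpha.
    rewrite powRM ?invr_ge0 ?(ltW t0) // /c -powRN.
    by rewrite -(powR_inv1 (ltW t0)) -powRrM mulN1r; ring.
  rewrite e; have : c * `|Z w| `^ alpha <= c * (`|Z w| `^ (1 + delta) + D).
    by rewrite ler_wpM2l // powR_min2_le.
  rewrite /F; lra.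
apply: (@le_trans _ _ (\int[P]_w (F w)%:E)%E).
  apply: ge0_le_integral => //.
  - apply/measurable_EFinP; apply: measurableT_comp => //.
    apply: measurable_funM => //; apply: measurable_funM => //.
    by apply: measurableT_comp => //; exact: measurable_huber_score.
  - by rewrite FE; apply: (measurable_int P); exact: integrableD.
  - by move=> w _; rewrite lee_fin; exact: Fge.
rewrite (_ : \int[P]_w (F w)%:E = \int[P]_w ((1 + c * D)%:E + (x / tau)%:E * (Z w)%:E
    + c%:E * (`|Z w| `^ (1 + delta))%:E))%E; last by rewrite -FE.
rewrite integralD // integralD //; last exact: integrableZl.
rewrite !integralZl // EZ mule0 adde0 integral_cst //.
apply: (@le_trans _ _ ((1 + c * D)%:E + c%:E * v%:E)%E).
  apply: leeD; last by rewrite lee_wpmul2l // lee_fin.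
  rewrite -[leRHS]mule1 lee_wpmul2l //; last exact: probability_le1.
  by rewrite lee_fin addr_ge0 // mulr_ge0 // ler0n.
rewrite -EFinM -EFinD lee_fin.
apply: le_trans (expR_ge1Dx _); rewrite le_eqVlt; apply/orP; left; apply/eqP.
by rewrite /c; ring.
Qed.

End Moments.

(** * Tail of the gradient *)

Section GradientTail.
Context {d : measure_display} {T : measurableType d} {R : realType}.
Variable P : probability T R.
Context {n p q : nat}.
Variables (X : 'M[R]_(n, p)) (E : 'I_n -> 'I_q -> {RV P >-> R}).

(** Row independence passes to one column by pulling events back along a coordinate; a gradient
    entry involves a single noise column. *)
Lemma independent_entries (j : 'I_q) (g : 'I_n -> R -> R) :
  mutually_independent P (noise_row E) -> (forall i, measurable_fun setT (g i)) ->
  forall B : 'I_n -> set R, (forall i, measurable (B i)) ->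
    P (\bigcap_(i in [set: 'I_n]) ((fun w => g i (E i j w)) @^-1` B i))%classic
    = (\prod_(i < n) P ((fun w => g i (E i j w)) @^-1` B i)%classic)%E.
Proof.
move=> indep mg B mB.
pose B' i : set (q.-tuple R) := ((fun t => g i (tnth t j)) @^-1` B i)%classic.
have mB' i : measurable (B' i).
  rewrite -[B' i]setTI.
  by apply: (measurableT_comp (mg i) (measurable_tnth j)).
have e i : ((fun w => g i (E i j w)) @^-1` B i)%classic = (noise_row E i @^-1` B' i)%classic.
  by rewrite /B' /noise_row; apply/seteqP; split=> w /=; rewrite tnth_mktuple.
rewrite (eq_bigcapr (fun i _ => e i)) indep //.
by apply: eq_bigr => i _; rewrite e.
Qed.

Variables (tau b lam : R).
Hypothesis tau_gt0 : 0 < tau.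

Let good : set T :=
  [set w | forall a j, `|score_gradient X tau (noise_mx E w) a j| <= lam]%classic.

Let S (a : 'I_p) (j : 'I_q) (w : T) : R :=
  \sum_i X i a * huber_score tau (E i j w) / tau.

Let gradE a j w :
  score_gradient X tau (noise_mx E w) a j = n%:R^-1 * (tau * S a j w).
Proof.
rewrite /score_gradient /S mulr_sumr; congr (_ * _).
by apply: eq_bigr => i _; rewrite mxE; field; rewrite gt_eqF.
Qed.

Let mS a j : measurable_fun setT (S a j).
Proof.
apply: measurable_sum => i; apply: measurable_funM => //; apply: measurable_funM => //.
apply: measurableT_comp; first exact: measurable_huber_score.
exact: measurable_funPT.
Qed.

Lemma measurable_gradient_bounded : measurable good.
Proof.
rewrite (_ : good = \bigcap_(c in [set: 'I_p * 'I_q])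
    ((fun w => `|score_gradient X tau (noise_mx E w) c.1 c.2|) @^-1` `]-oo, lam]))%classic; last first.
  apply/seteqP; split=> w /=.
    by move=> h [a j] _ /=; rewrite in_itv /= h.
  by move=> h a j; have := h (a, j) I; rewrite /= in_itv.
apply: fin_bigcap_measurable => [|c _]; first exact: finite_finset.
rewrite -[X in measurable X]setTI.
suff : measurable_fun setT (fun w => `|score_gradient X tau (noise_mx E w) c.1 c.2|) by apply.
apply: measurableT_comp => //.
rewrite (_ : (fun w => _) = (fun w => n%:R^-1 * (tau * S c.1 c.2 w))).
  by apply: measurable_funM => //; apply: measurable_funM.
by apply/funext => w; rewrite gradE.
Qed.

(** Chernoff bound at the point [1 / tau], with a union over two signs and the entries, whence the
    factor [2 * (p * q)]. On the bad event some [G c] is at least 1, so their sum dominates its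
    indicator. *)
Lemma probability_gradient_unbounded :
  (0 < n)%N -> (forall i a, `|X i a| <= 1) ->
  mutually_independent P (noise_row E) ->
  (forall i j x, `|x| <= 1 ->
     (\int[P]_w (expR (x * huber_score tau (E i j w) / tau))%:E <= (expR b)%:E)%E) ->
  (P (~` good)%classic
   <= (2 * (p * q)%:R * expR (1 + n%:R * b - n%:R * lam / tau))%:E)%E.
Proof.
move=> n0 X1 indep hb.
have nR : 0 < n%:R :> R by rewrite ltr0n.
set theta := n%:R * lam / tau.
pose G (c : bool * ('I_p * 'I_q)) w : R :=
  expR (- theta) * expR ((-1) ^+ c.1 * S c.2.1 c.2.2 w).
have mG c : measurable_fun setT (G c).
  apply: measurable_funM => //; apply: measurableT_comp => //.
  by apply: measurable_funM.
have intG c : (\int[P]_w (G c w)%:E <= (expR (1 + n%:R * b - theta))%:E)%E.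
  under eq_integral => w _ do rewrite EFinM.
  rewrite ge0_integralZl_EFin ?expR_ge0 //; last first.
    apply/measurable_EFinP; apply: measurableT_comp => //.
    by apply: measurable_funM.
  rewrite addrC expRD EFinM lee_wpmul2l ?lee_fin ?expR_ge0 //.
  pose g i z := ((-1) ^+ c.1 * X i c.2.1) * huber_score tau z / tau.
  have x1 i : `|(-1) ^+ c.1 * X i c.2.1| <= 1 by rewrite normrM normr_sign mul1r.
  have mg i : measurable_fun setT (g i).
    apply: measurable_funM => //; apply: measurable_funM => //.
    exact: measurable_huber_score.
  have -> : 1 + n%:R * b = 1 + \sum_(i < n) b.
    by rewrite sumr_const card_ord mulr_natl.
  rewrite (eq_integral (fun w => (expR (\sum_i g i (E i c.2.2 w)))%:E)); last first.
    move=> w _; congr (expR _)%:E.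
    by rewrite /S /g mulr_sumr; apply: eq_bigr => i _; ring.
  apply: (expectation_exp_sum_le (Z := fun i w => g i (E i c.2.2 w))).
  - by move=> i; apply: measurableT_comp => //; exact: measurable_funPT.
  - move=> i w; rewrite /g !normrM normfV (gtr0_norm tau_gt0) -normrM.
    rewrite -[leRHS](divff (lt0r_neq0 tau_gt0)) ler_wpM2r ?invr_ge0 ?(ltW tau_gt0) //.
    by rewrite -[leRHS]mul1r ler_pM // huber_score_bound.
  - exact: independent_entries.
  - by move=> i; exact: hb.
have mbad : measurable (~` good)%classic.
  exact: measurableC measurable_gradient_bounded.
rewrite -[(~` good)%classic]setIT -integral_indic //.
apply: (@le_trans _ _ (\int[P]_w (\sum_c (G c w)%:E))%E).
  apply: ge0_le_integral => //.
  - by apply/measurable_EFinP; exact: measurable_indic.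
  - by apply: emeasurable_sum => c; exact/measurable_EFinP.
  - move=> w _; rewrite sumEFin lee_fin indicE.
    have [|_] := boolP (w \in _); last by apply: sumr_ge0 => c _; rewrite mulr_ge0 ?expR_ge0.
    rewrite inE => /existsNP[a /existsNP[j /negP]]; rewrite -ltNge gradE => h.
    have {}h : theta < `|S a j w|.
      move: h; rewrite !normrM normfV (gtr0_norm nR) (gtr0_norm tau_gt0).
      rewrite -ltr_pdivrMl ?invr_gt0 // invrK -ltr_pdivrMl // /theta.
      by rewrite mulrC.
    pose sg := S a j w < 0.
    rewrite (bigD1 (sg, (a, j))) //= ler_wpDr //.
      by apply: sumr_ge0 => c _; rewrite mulr_ge0 ?expR_ge0.
    rewrite /G /=; have -> : (-1) ^+ sg * S a j w = `|S a j w|.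
      by rewrite /sg; case: ltP => hs; rewrite ?mulN1r ?mul1r;
        [rewrite ltr0_norm|rewrite ger0_norm].
    rewrite -expRD; apply: le_trans (expR_ge1Dx _).
    by rewrite lerDl; lra.
rewrite ge0_integral_sum // => [|c|c w _]; last 2 first.
- exact/measurable_EFinP.
- by rewrite lee_fin mulr_ge0 ?expR_ge0.
apply: le_trans (lee_sum _ (fun c _ => intG c)) _.
rewrite sumEFin lee_fin sumr_const !card_prod card_bool !card_ord -[leLHS]mulr_natl.
by rewrite natrM.
Qed.

End GradientTail.

(** * Rates *)

Lemma rate_exponentE {R : realType} (delta : R) : 0 < delta ->
  Num.min (delta / (1 + delta)) (1 / 2) = 1 - (Num.min (1 + delta) 2)^-1.
Proof.
move=> d0; have p0 : 0 < 1 + delta by lra.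
have [h|h] := leP (1 + delta) 2.
  rewrite min_l; first by field; rewrite gt_eqF.
  by rewrite ler_pdivrMr //; lra.
rewrite min_r; first by field.
by rewrite ler_pdivlMr //; lra.
Qed.

(** With [x = log_dim p q / n], both sides are v^(1/alpha) x^(1 - 1/alpha), where alpha = min(1 +
    delta, 2). Hence [n * lambda / tau] is at least of order [log_dim p q]. *)
Lemma stat_rateE {R : realType} (delta v : R) (n p q : nat) :
  0 < delta -> 0 < v -> (0 < n)%N -> 0 < log_dim p q :> R ->
  stat_rate delta v n p q = log_dim p q / n%:R * tau_rate delta v n p q.
Proof.
move=> d0 v0 n0 L0; have nR : 0 < n%:R :> R by rewrite ltr0n.
rewrite /stat_rate /tau_rate rate_exponentE //.
set a := (Num.min _ _)^-1; set L := log_dim p q in L0 *.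
have -> : n%:R * v / L = v * (L / n%:R)^-1 by rewrite invf_div; ring.
have x0 : 0 < L / n%:R by rewrite divr_gt0.
set x := L / n%:R in x0 *.
rewrite (powRM _ (ltW v0)) ?invr_ge0 ?(ltW x0) // [RHS]mulrCA; congr (_ * _).
rewrite powRB; last by rewrite (gt_eqF x0) implybT.
rewrite (powRr1 (ltW x0)); congr (_ * _).
by rewrite -powRN -(powR_inv1 (ltW x0)) -powRrM mulN1r.
Qed.

(** * Entrywise maxima, moments and size of the support *)

Lemma max_abs_entry_ge {R : realType} {n p : nat} (X : 'M[R]_(n, p)) i a :
  `|X i a| <= max_abs_entry X.
Proof.
apply: le_trans (le_bigmax _ _ i).
exact: (le_bigmax _ (fun a => `|X i a|) a).
Qed.

Lemma max_abs_entry_dim {R : realType} {n p : nat} (X : 'M[R]_(n, p)) :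
  max_abs_entry X = 1 -> (0 < n)%N /\ (0 < p)%N.
Proof.
move=> X1; have /eqP n0 : max_abs_entry X != 0 by rewrite X1 oner_eq0.
case: n X X1 n0 => [|n] X X1 n0; first by rewrite /max_abs_entry big_ord0 in n0.
case: p X X1 n0 => [|p] X X1 n0; last by [].
exfalso; apply: n0; rewrite /max_abs_entry.
by elim/big_ind: _ => // [x y -> ->|i _]; rewrite ?maxxx // big_ord0.
Qed.

Lemma max_moment_ge {d : measure_display} {T : measurableType d} {R : realType}
    (P : probability T R) {n q : nat} (E : 'I_n -> 'I_q -> {RV P >-> R})
    (delta : R) i j :
  ('E_P[fun w => (`|E i j w| `^ (1 + delta))%R] <= max_moment E delta)%E.
Proof.
apply: le_trans (le_bigmax _ _ i).
exact: (le_bigmax _ (fun j => 'E_P[fun w => (`|E i j w| `^ (1 + delta))%R])%E j).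
Qed.

(** A nonzero entry needs some [k] with both factors nonzero, and each [k] allows at most
    [s_u * s_v] positions. *)
Lemma card_supp_factorization {R : realType} {p q r s_u s_v : nat}
    (U : 'M[R]_(p, r)) (Lam : 'rV[R]_r) (V : 'M[R]_(q, r)) :
  column_sparse s_u U -> column_sparse s_v V ->
  (#|supp (U *m diag_mx Lam *m V^T)| <= r * s_u * s_v)%N.
Proof.
move=> hU hV.
apply: (@leq_trans (\sum_(ij : 'I_p * 'I_q) \sum_(k < r)
    ((U ij.1 k != 0%R) * (V ij.2 k != 0%R)))%N).
  rewrite -sum1_card big_mkcond; apply: leq_sum => -[i j] _ /=.
  case: ifP => //; rewrite inE /=; apply: contraTT; rewrite -eqn0Ngt => /eqP e.
  rewrite negbK; apply/eqP; rewrite mxE; apply: big1 => k _.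
  rewrite mul_mx_diag !mxE.
  have : ((U i k != 0%R) * (V j k != 0%R))%N = 0%N.
    by apply/eqP; rewrite -leqn0 -e (bigD1 k) //= leq_addr.
  by case: eqP => [->|_]; case: eqP => [->|_] //; rewrite ?mul0r ?mulr0.
rewrite exchange_big /= -mulnA.
have -> : (r * (s_u * s_v))%N = (\sum_(k < r) s_u * s_v)%N.
  by rewrite sum_nat_const card_ord.
apply: leq_sum => k _.
rewrite -(pair_bigA _ (fun i j => (U i k != 0%R) * (V j k != 0%R))%N) /=.
apply: (@leq_trans (#|[pred i | U i k != 0%R]| * #|[pred j | V j k != 0%R]|)%N);
  last exact: leq_mul.
have cardE m' (F : 'I_m' -> bool) : #|[pred i | F i]| = (\sum_i F i)%N.
  by rewrite -sum1_card big_mkcond; apply: eq_bigr => i _; rewrite inE; case: (F i).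
rewrite !cardE big_distrl; apply: leq_sum => i _.
by rewrite big_distrr.
Qed.

Lemma ln2_ge_half {R : realType} : 1 / 2 <= ln 2 :> R.
Proof.
rewrite -[leLHS]expRK ler_ln ?posrE ?expR_gt0 //.
have : 2^-1 <= (expR (1 / 2))^-1 :> R.
  by rewrite -expRN; have := expR_ge1Dx (- (1 / 2) : R); lra.
by rewrite lef_pV2 ?posrE ?expR_gt0.
Qed.

(** The size of [tau] makes [n * b] at most [K1 * log_dim], and the size of [lambda] makes
    [n * lambda / tau] at least [(K1 + 5) * log_dim]. The summand 1 is at most [2 * log_dim] because
    [log_dim >= 1 / 2]. *)
Lemma tail_exponent_le {R : realType} (delta v0 v c_tau C_tau tau lambda : R)
    (n p q : nat) :
  let K1 := 3 * (1 + v0^-1) / c_tau `^ Num.min (1 + delta) 2 in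
  let b := 3 * (v + (1 < delta)%R%:R) / tau `^ Num.min (1 + delta) 2 in
  0 < delta -> 0 < v0 -> (1 < delta -> v0 <= v) -> 0 < v ->
  0 < c_tau -> 0 < C_tau -> (0 < n)%N -> (1 < p * q)%N -> 0 < tau ->
  c_tau * tau_rate delta v n p q <= tau <= C_tau * tau_rate delta v n p q ->
  C_tau * (K1 + 5) * stat_rate delta v n p q <= lambda ->
  1 + n%:R * b - n%:R * (3 / 2 * lambda) / tau <= - (3 * log_dim p q).
Proof.
move=> K1 b d0 v00 v0v v_gt0 c0 C0 n0 pq1 tau0 /andP[tl tu] hlam.
have nR : 0 < n%:R :> R by rewrite ltr0n.
have L2 : 1 / 2 <= log_dim p q :> R.
  by apply: le_trans ln2_ge_half _; rewrite ler_ln ?posrE ?ltr0n ?ler_nat // (ltn_trans _ pq1).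
set L := log_dim p q in L2 *; have L0 : 0 < L by lra.
pose alpha := Num.min (1 + delta) 2.
have a0 : 0 < alpha by rewrite /alpha lt_min; apply/andP; split; lra.
have K10 : 0 <= K1.
  by rewrite divr_ge0 ?powR_ge0 // mulr_ge0 // addr_ge0 // invr_ge0 ltW.
have x0 : 0 <= n%:R * v / L by rewrite divr_ge0 ?mulr_ge0 ?(ltW v_gt0) ?(ltW L0) ?(ltW nR).
have tr0 : 0 < tau_rate delta v n p q by rewrite powR_gt0 // divr_gt0 // mulr_gt0.
have nb : n%:R * b <= K1 * L.
  have ta : c_tau `^ alpha * (n%:R * v / L) <= tau `^ alpha.
    have -> : n%:R * v / L = tau_rate delta v n p q `^ alpha.
      by rewrite /tau_rate -/alpha -/L -powRrM mulVf ?gt_eqF // powRr1.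
    rewrite -powRM ?(ltW c0) ?(ltW tr0) //.
    by rewrite ge0_ler_powR ?nnegrE ?(ltW a0) ?(ltW tau0) ?mulr_ge0 ?(ltW c0) ?(ltW tr0).
  (* For [delta > 1] the indicator is absorbed using [v0 <= v]. *)
  have vD : v + (1 < delta)%R%:R <= (1 + v0^-1) * v.
    have h : 0 <= v0^-1 * v by rewrite mulr_ge0 ?invr_ge0 ?ltW.
    have [d1|d1] := ltP 1 delta; last by rewrite addr0; lra.
    have : 1 <= v0^-1 * v by rewrite mulrC ler_pdivlMr // mul1r v0v.
    rewrite /=; lra.
  have ca : 0 < c_tau `^ alpha by rewrite powR_gt0.
  have tap : 0 < tau `^ alpha by rewrite powR_gt0.
  rewrite /b -/alpha mulrA ler_pdivrMr //.
  apply: (@le_trans _ _ (K1 * L * (c_tau `^ alpha * (n%:R * v / L)))); last first.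
    by rewrite ler_wpM2l // mulr_ge0 // ltW.
  have -> : K1 * L * (c_tau `^ alpha * (n%:R * v / L)) = n%:R * (3 * ((1 + v0^-1) * v)).
    by rewrite /K1 -/alpha; field; rewrite !gt_eqF.
  by rewrite ler_pM2l // ler_pM2l.
have nl : (K1 + 5) * L <= n%:R * lambda / tau.
  rewrite ler_pdivlMr //.
  apply: (@le_trans _ _ ((K1 + 5) * L * (C_tau * tau_rate delta v n p q))).
    by rewrite ler_wpM2l // mulr_ge0 ?(ltW L0) // addr_ge0.
  have : n%:R * (C_tau * (K1 + 5) * stat_rate delta v n p q) <= n%:R * lambda.
    by rewrite ler_pM2l.
  apply: le_trans; rewrite stat_rateE // -/L.
  by rewrite le_eqVlt; apply/orP; left; apply/eqP; field; rewrite gt_eqF.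
have -> : n%:R * (3 / 2 * lambda) / tau = 3 / 2 * (n%:R * lambda / tau) by ring.
have : 0 <= K1 * L by rewrite mulr_ge0 // ltW.
lra.
Qed.

Theorem theorem1 (R : realType) :
  exists C : R, 0 < C /\
  (* fixed parameters; v0 only matters when delta > 1 *)
  forall gamma delta v0 : R, 5 / 2 < gamma -> 0 < delta -> 0 < v0 ->
  (* implicit constants in the choice of tau *)
  forall c_tau C_tau : R, 0 < c_tau -> c_tau <= C_tau ->
  (* "sufficiently large" constants in the choice of lambda and eta *)
  exists c_lambda c_eta : R, 0 < c_lambda /\ 0 < c_eta /\
  forall C_lambda : R, c_lambda <= C_lambda ->
  (* implicit constant of the conclusion *)
  exists K : R, 0 < K /\
  forall (n p q r s_u s_v m : nat)
    (d : measure_display) (T : measurableType d) (P : probability T R)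
    (X : 'M[R]_(n, p)) (E : 'I_n -> 'I_q -> {RV P >-> R})
    (U : 'M[R]_(p, r)) (Lam : 'rV[R]_r) (V : 'M[R]_(q, r))
    (Astar : 'M[R]_(p, q)) (Y : T -> 'M[R]_(n, q)) (Ahat : T -> 'M[R]_(p, q))
    (v tau lambda eta klower kupper : R),
  let s := #|supp Astar| in
  let xi := (2 * gamma + 5) / (2 * gamma - 5) in
  (0 < q)%N ->
  (* model *)
  max_abs_entry X = 1 ->
  (forall w, Y w = X *m Astar + noise_mx E w) ->
  mutually_independent P (noise_row E) ->
  (forall i j, 'E_P[E i j] = 0)%E ->
  (* structure of the coefficient matrix *)
  Astar = U *m diag_mx Lam *m V^T ->
  orthonormal_columns U -> orthonormal_columns V ->
  column_sparse s_u U -> column_sparse s_v V ->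
  (s_u < n)%N -> (s_v < n)%N -> (r < n)%N -> (r * s_u * s_v < n)%N ->
  (* bounded moments *)
  max_moment E delta = v%:E ->
  (1 < delta -> v0 <= v) ->
  (* truncation and tuning parameters *)
  0 < tau -> 0 < lambda ->
  c_tau * tau_rate delta v n p q <= tau <= C_tau * tau_rate delta v n p q ->
  c_lambda * stat_rate delta v n p q <= lambda
    <= C_lambda * stat_rate delta v n p q ->
  (* restricted eigenvalue constants and localization radius *)
  0 < klower -> klower <= kupper ->
  c_eta * (klower^-1 * lambda * s%:R) <= eta ->
  C * s%:R ^+ 2 * log_dim p q < n%:R ->
  (forall w, huber_solution X (Y w) tau lambda gamma (Ahat w)) ->
  exists Omega0 : set T,
    [/\ measurable Omega0,
        ((1 - (p * q)%:R^-1)%:E <= P Omega0)%E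
      & forall w, Omega0 w ->
          localized_RE X (Y w) tau Astar m xi eta klower kupper ->
          frob_norm (Ahat w - Astar)
            <= K * (klower^-1 * v `^ (Num.min (1 + delta) 2)^-1
                    * Num.sqrt (r * s_u * s_v)%:R
                    * (log_dim p q / n%:R)
                        `^ Num.min (delta / (1 + delta)) (1 / 2))
          /\
          nuclear_norm (Ahat w - Astar)
            <= K * (klower^-1 * v `^ (Num.min (1 + delta) 2)^-1
                    * (r * s_u * s_v)%:R
                    * (log_dim p q / n%:R)
                        `^ Num.min (delta / (1 + delta)) (1 / 2))].

Proof.
exists 1; split=> // gamma delta v0 gam d0 v00 c_tau C_tau c0 cC.
have C0 : 0 < C_tau by apply: lt_le_trans cC.
pose K1 := 3 * (1 + v0^-1) / c_tau `^ Num.min (1 + delta) 2.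
have K10 : 0 <= K1.
  by rewrite divr_ge0 ?powR_ge0 // mulr_ge0 // addr_ge0 // invr_ge0 ltW.
pose xi := (2 * gamma + 5) / (2 * gamma - 5).
have xi0 : 0 < xi by apply: divr_gt0; lra.
pose B := (1 + xi) * (4 * (gamma + 5 / 2)).
have g0 : 0 < 4 * (gamma + 5 / 2) by lra.
have B0 : 0 < B by apply: mulr_gt0 => //; lra.
(* The first constant is the one of [tail_exponent_le]; the added 1 in the second makes the lower
   bound on [eta] strict. *)
exists (C_tau * (K1 + 5)), (B + 1); split; first by apply: mulr_gt0 => //; lra.
split; first by lra.
move=> C_lambda hC; exists (B * C_lambda).
have CL0 : 0 < C_lambda by apply: lt_le_trans hC; apply: mulr_gt0 => //; lra.
split; first exact: mulr_gt0.
move=> n p q r s_u s_v m d T P X E U Lam V Astar Y Ahat v tau lambda eta kl ku.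
move=> s xi' q0 X1 hY indep EE hA oU oV sU sV _ _ _ _ hv hv0 tau0 lam0 htau.
move=> /andP[hl hu] kl0 klu heta _ hsol.
have [n0 p0] := max_abs_entry_dim X1.
have nR : 0 < n%:R :> R by rewrite ltr0n.
(* When [p * q = 1] the required probability is 0, so the empty event suffices. *)
have [pq1|pq1] := leqP (p * q) 1.
  exists set0; split=> //; rewrite measure0 lee_fin subr_le0.
  have -> : (p * q)%N = 1%N by apply/eqP; rewrite eqn_leq pq1 muln_gt0 p0 q0.
  by rewrite invr1.
have v_ge0 : 0 <= v.
  have := max_moment_ge E delta (Ordinal n0) (Ordinal q0); rewrite hv -[0 <= v]lee_fin; apply: le_trans.
  by apply: expectation_ge0 => w; exact: powR_ge0.
(* A zero moment would make [tau_rate] zero and force [tau <= 0]. *)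
have v_gt0 : 0 < v.
  rewrite lt_neqAle v_ge0 andbT eq_sym; apply/eqP => v00'.
  move: htau; rewrite /tau_rate v00' mulr0 mul0r powR0 ?mulr0; last first.
    by rewrite invr_eq0 gt_eqF // lt_min; apply/andP; split; lra.
  by move=> /andP[_]; rewrite leNgt tau0.
pose b := 3 * (v + (1 < delta)%R%:R) / tau `^ Num.min (1 + delta) 2.
have hexp := tail_exponent_le d0 v00 hv0 v_gt0 c0 C0 n0 pq1 tau0 htau hl.
pose good : set T :=
  [set w | forall a j, `|score_gradient X tau (noise_mx E w) a j| <= 3 / 2 * lambda]%classic.
have mgood : measurable good by exact: measurable_gradient_bounded.
exists good; split=> //.
  have bad : (P (~` good)%classic <= ((p * q)%:R^-1)%:E)%E.
    have := @probability_gradient_unbounded _ _ _ P n p q X E tau b (3 / 2 * lambda)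
      tau0 n0 _ indep _.
    move/(_ _ _)/le_trans; apply.
    - by move=> i a; rewrite -X1; exact: max_abs_entry_ge.
    - move=> i j x x1; apply: expectation_exp_score_le => //.
      by rewrite -hv; exact: max_moment_ge.
    rewrite lee_fin; have := hexp; rewrite -ler_expR => he.
    have pqR : 1 < (p * q)%:R :> R by rewrite ltr1n.
    set N := (p * q)%:R in pqR *.
    have N0 : 0 < N by lra.
    (* The bound becomes 2 N N^(-3), which is at most 1/N since [N >= 2]. *)
    apply: (@le_trans _ _ (2 * N * expR (- (3 * log_dim p q)))).
      by rewrite ler_wpM2l // mulr_ge0 // ltW.
    have -> : expR (- (3 * log_dim p q)) = N ^- 3.
      rewrite expRN; congr (_^-1).
      by rewrite expRM_natl lnK // posrE.
    have N2 : 2 <= N by rewrite (ler_nat _ 2).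
    have N3 : 0 < N ^- 3 by rewrite invr_gt0 exprn_gt0.
    rewrite -ler_pdivlMr //.
    rewrite invrK exprS mulKf ?gt_eqF //.
    by rewrite expr2 ler_pM2r.
  have -> : P good = (1 - P (~` good)%classic)%E.
    by rewrite -probability_setC ?setCK //; exact: measurableC.
  by rewrite EFinB leeB.
move=> w hw hRE.
have hres : Y w - X *m Astar = noise_mx E w by rewrite hY addrC addKr.
have [||h1 h2] := @huber_estimation_error R n p q X (Y w) tau lambda gamma eta kl ku m
   Astar (Ahat w) tau0 lam0 gam kl0 _ _ (hsol w) hRE.
- move=> s0; apply: lt_le_trans heta.
  have sR : 0 < s%:R :> R by rewrite ltr0n.
  have : 0 < kl^-1 * lambda * s%:R by rewrite !mulr_gt0 // invr_gt0.
  rewrite -/s -/xi /B; lra.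
- by rewrite hres.
have sle : s%:R <= (r * s_u * s_v)%:R :> R.
  by rewrite ler_nat /s hA; exact: card_supp_factorization.
have kli : 0 < kl^-1 by rewrite invr_gt0.
have lamle : kl^-1 * lambda <= kl^-1 * (C_lambda * stat_rate delta v n p q).
  by rewrite ler_pM2l.
have kll0 : 0 <= kl^-1 * lambda by rewrite mulr_ge0 // ltW.
split.
  apply: le_trans h1 _.
  have sqle : Num.sqrt s%:R <= Num.sqrt (r * s_u * s_v)%:R :> R by rewrite ler_wsqrtr.
  have h := ler_pM kll0 (sqrtr_ge0 s%:R) lamle sqle.
  (* The Frobenius bound lacks the factor [1 + xi], which is at least 1, so one constant [K] serves
     both norms. *)
  have {}h : 4 * (gamma + 5 / 2) * (kl^-1 * lambda * Num.sqrt s%:R) <=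
    B * (kl^-1 * (C_lambda * stat_rate delta v n p q) * Num.sqrt (r * s_u * s_v)%:R).
    apply: ler_pM h => //; first exact: ltW.
      by rewrite mulr_ge0.
    by rewrite /B ler_peMl ?(ltW g0) // lerDl ltW.
  rewrite -mulrA; apply: le_trans h _; rewrite /stat_rate.
  by rewrite le_eqVlt; apply/orP; left; apply/eqP; ring.
apply: le_trans h2 _.
have h := ler_pM kll0 (ler0n _ s) lamle sle.
have {}h : B * (kl^-1 * lambda * s%:R) <=
  B * (kl^-1 * (C_lambda * stat_rate delta v n p q) * (r * s_u * s_v)%:R).
  by rewrite ler_pM2l.
rewrite -/s -/xi; apply: le_trans (_ : B * (kl^-1 * lambda * s%:R) <= _).
  by rewrite le_eqVlt; apply/orP; left; apply/eqP; rewrite /B; ring.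
apply: le_trans h _; rewrite /stat_rate.
by rewrite le_eqVlt; apply/orP; left; apply/eqP; ring.
Qed.
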